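(* Let $a>0$, $\nu>0$ be constants, let $\mathbb{H}^2(-a^2)$ be the $2$-dimensional space form of constant negative sectional curvature $-a^2$, let $O\in\mathbb{H}^2(-a^2)$ be a selected base point, and let $(r,\theta)$ be the normal polar coordinate system on $\mathbb{H}^2(-a^2)$ about $O$, with induced vector fields $\frac{\partial}{\partial r},\frac{\partial}{\partial\theta}$. Let $\delta\in(0,\infty)$, and let $K$ be a compact subset of $\{p\in\mathbb{H}^2(-a^2): d(p,O)\le\delta\}$ (an obstacle) such that, for some $\tau\in(0,2\pi)$, the circular arc $C_{\delta,\tau}=\{p\in\mathbb{H}^2(-a^2): d(p,O)=\delta,\ 0<\theta(p)<\tau\}$ is a smooth boundary portion of $\partial K$, i.e. $C_{\delta,\tau}\subset\partial K$. Consider the stationary Navier-Stokes equation $$\nu\big((-\triangle)u^*-2\,\mathrm{Ric}(u^* )\big)+[\overline{\nabla}_u u]^*+dP=0,\qquad d^*u^*=0.\qquad(\mathrm{NS})$$ Then the following two assertions hold. (Assertion I) For the quadratic profile $h(\lambda)=\alpha_1\lambda-\frac{\alpha_2}{2}\lambda^2$ with any prescribed constants $\alpha_1>0$, $\alpha_2>0$, the velocity field $u=-h(r-\delta)\frac{a}{\sinh(ar)}\frac{\partial}{\partial\theta}$ does not satisfy (NS) (with any smooth pressure $P$) on any sector-shaped region $$R_{\delta,\tau,\epsilon_0}=\{p\in\mathbb{H}^2(-a^2): \delta<d(p,O)<\delta+\epsilon_0,\ 0<\theta(p)<\tau\},$$ regardless of how small $\epsilon_0>0$ may be. (Assertion II)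 For any prescribed $\alpha_1>0$, $\alpha_2>0$, there exists a unique smooth function $Y:[\delta,\infty)\to\mathbb{R}$ satisfying $Y(\delta)=0$, $Y'(\delta)=\alpha_1$, $Y''(\delta)=-\alpha_2$ such that the associated parallel laminar flow $u=-Y(r)\frac{a}{\sinh(ar)}\frac{\partial}{\partial\theta}$ satisfies (NS) (for some smooth pressure $P$) on the simply-connected exterior region $$\Omega_{\delta,\tau}=\{p\in\mathbb{H}^2(-a^2): d(p,O)>\delta,\ 0<\theta(p)<\tau\},$$ which shares the circular-arc boundary portion $C_{\delta,\tau}$ with $\partial K$. Moreover, this unique function $Y$ is real-analytic on $[\delta,\infty)$.
   Context: $\mathbb{H}^2(-a^2)$ is the hyperbolic plane of constant sectional curvature $-a^2$ (complete, simply connected, oriented), with Riemannian metric $g$ and geodesic distance $d(\cdot,\cdot)$. The exponential map $\exp_O:T_O\mathbb{H}^2(-a^2)\to\mathbb{H}^2(-a^2)$ is a diffeomorphism; identifying $T_O\mathbb{H}^2(-a^2)$ with $\mathbb{R}^2$ by a positively oriented orthonormal basis, the normal polar coordinate system is $(r,\theta)=(\overline r,\overline\theta)\circ\exp_O^{-1}$, where $(\overline r,\overline\theta)$ are the standard polar coordinates on $\mathbb{R}^2\setminus\{(x_1,0):x_1\ge0\}$ with values in $(0,\infty)\times(0,2\pi)$. So $r(p)=d(p,O)$, and $\frac{\partial}{\partial r},\frac{\partial}{\partial\theta}$ are the induced coordinate vector fields; the metric is $g=dr^2+\frac{\sinh^2(ar)}{a^2}d\theta^2$, and $(dr,d\theta)$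 is positively oriented. For a smooth vector field $X$, $X^*=g(X,\cdot)$ is the associated $1$-form. $\overline\nabla$ is the Levi-Civita connection. $*$ is the Hodge star, with $*dr=\frac{\sinh(ar)}{a}d\theta$, $*d\theta=-\frac{a}{\sinh(ar)}dr$, and $*\mathrm{Vol}=1$ where $\mathrm{Vol}=\frac{\sinh(ar)}{a}dr\wedge d\theta$. $d^*=-*d*$ is the formal adjoint of the exterior derivative $d$ (on $1$-forms $d^*u^*=-\mathrm{div}\,u$), and $(-\triangle)=dd^*+d^*d$ is the Hodge Laplacian on $1$-forms. $\mathrm{Ric}$ is the Ricci tensor acting on $1$-forms; on $\mathbb{H}^2(-a^2)$, $\mathrm{Ric}(u^* )=-a^2u^*$. The constant $\nu>0$ is the viscosity. A vector field $u$ ''satisfies'' (NS) on a region if there is a smooth pressure function $P$ on that region such that the system holds there. *)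

(* Defs.v *)
From Stdlib Require Import Reals List.
From Coquelicot Require Import Coquelicot.

Open Scope R_scope.

Definition R3 : NormedModule R_AbsRing :=
  prod_NormedModule R_AbsRing
    (prod_NormedModule R_AbsRing R_NormedModule R_NormedModule) R_NormedModule.

Definition crd0 (p : R3) : R := fst (fst p).
Definition crd1 (p : R3) : R := snd (fst p).
Definition crd2 (p : R3) : R := snd p.

(** Lorentzian inner product; its restriction to the tangent planes of the
    sheet [H2] below is the (positive definite) Riemannian metric. *)
Definition mink (p q : R3) : R := - (crd0 p * crd0 q) + crd1 p * crd1 q + crd2 p * crd2 q.

Definition det3 (p q v : R3) : R :=
  crd0 p * (crd1 q * crd2 v - crd2 q * crd1 v)
  - crd1 p * (crd0 q * crd2 v - crd2 q * crd0 v)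
  + crd2 p * (crd0 q * crd1 v - crd1 q * crd0 v).

(** Hyperboloid model of the hyperbolic plane of curvature [-a^2]. *)
Definition H2 (a : R) (p : R3) : Prop := mink p p = - / a ^ 2 /\ 0 < crd0 p.

Definition arcosh (x : R) : R := ln (x + sqrt (x ^ 2 - 1)).

(** Geodesic distance: [cosh (a d(p,q)) = - a^2 <p,q>]. *)
Definition hyp_dist (a : R) (p q : R3) : R := arcosh (- a ^ 2 * mink p q) / a.

(** The tangent plane of [H2 a] at [O] is [{v | mink O v = 0}]; [H2 a] is
    oriented by declaring a tangent basis [(v, w)] at [p] positive when
    [det3 p v w > 0]. *)
Definition oriented_orthonormal_basis (O e1 e2 : R3) : Prop :=
  mink O e1 = 0 /\ mink O e2 = 0 /\
  mink e1 e1 = 1 /\ mink e2 e2 = 1 /\ mink e1 e2 = 0 /\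
  0 < det3 O e1 e2.

Definition tangent_norm (v : R3) : R := sqrt (mink v v).

(** [t |-> hyp_exp a O (t v)] is the geodesic with initial velocity [v].  For
    [v = 0] the coefficient of [v] is irrelevant. *)
Definition hyp_exp (a : R) (O v : R3) : R3 :=
  plus (scal (cosh (a * tangent_norm v)) O)
       (scal (sinh (a * tangent_norm v) / (a * tangent_norm v)) v).

(** Inverse of the normal polar coordinate system [(r, theta)] about [O], with
    [T_O H2] identified with [R^2] through the basis [(e1, e2)]. *)
Definition polar_map (a : R) (O e1 e2 : R3) (r th : R) : R3 :=
  hyp_exp a O (plus (scal (r * cos th) e1) (scal (r * sin th) e2)).

Definition polar_domain (r th : R) : Prop := 0 < r /\ 0 < th < 2 * PI.

Definition polar_coord (a : R) (O e1 e2 p : R3) (r th : R) : Prop :=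
  polar_domain r th /\ p = polar_map a O e1 e2 r th.

Inductive idx : Set := X1 | X2.

Definition sum_idx (f : idx -> R) : R := f X1 + f X2.

Definition pd (i : idx) (f : R -> R -> R) (x y : R) : R :=
  match i with
  | X1 => Derive (fun t => f t y) x
  | X2 => Derive (fun t => f x t) y
  end.

Definition ex_pd (i : idx) (f : R -> R -> R) (x y : R) : Prop :=
  match i with
  | X1 => ex_derive (fun t => f t y) x
  | X2 => ex_derive (fun t => f x t) y
  end.

Fixpoint Ck (k : nat) (U : R -> R -> Prop) (f : R -> R -> R) : Prop :=
  (forall x y, U x y -> continuity_2d_pt f x y) /\
  match k with
  | O => True
  | S k' => forall i, (forall x y, U x y -> ex_pd i f x y) /\ Ck k' U (pd i f)
  end.

Definition smooth_2d (U : R -> R -> Prop) (f : R -> R -> R) : Prop :=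
  forall k, Ck k U f.

(** In an oriented coordinate chart [(x^1, x^2)]: vector fields and 1-forms are given by their components in the frames
    [d/dx^i] and [dx^i]; a 2-form is given by its coefficient on
    [dx^1 /\ dx^2]. *)

Definition field := R -> R -> R.
Definition vfield := idx -> field.
Definition form1 := idx -> field.
Definition form2 := field.
Definition metric := idx -> idx -> field.

Definition gdet (g : metric) : field := fun x y =>
  g X1 X1 x y * g X2 X2 x y - g X1 X2 x y * g X2 X1 x y.

Definition ginv (g : metric) : metric := fun i j x y =>
  match i, j with
  | X1, X1 => g X2 X2 x y / gdet g x y
  | X2, X2 => g X1 X1 x y / gdet g x y
  | _, _ => - g i j x y / gdet g x y
  end.

Definition flat (g : metric) (u : vfield) : form1 := fun i x y =>
  sum_idx (fun j => g i j x y * u j x y).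

Definition christoffel (g : metric) (k i j : idx) : field := fun x y =>
  / 2 * sum_idx (fun l => ginv g k l x y *
    (pd i (g j l) x y + pd j (g i l) x y - pd l (g i j) x y)).

Definition nabla (g : metric) (u v : vfield) : vfield := fun k x y =>
  sum_idx (fun i => u i x y *
    (pd i (v k) x y + sum_idx (fun j => christoffel g k i j x y * v j x y))).

Definition ricci (g : metric) (j k : idx) : field := fun x y =>
  sum_idx (fun i =>
    pd i (christoffel g i j k) x y - pd j (christoffel g i i k) x y +
    sum_idx (fun p =>
      christoffel g i i p x y * christoffel g p j k x y -
      christoffel g i j p x y * christoffel g p i k x y)).

Definition Ric (g : metric) (w : form1) : form1 := fun i x y =>
  sum_idx (fun j => sum_idx (fun k =>
    ricci g i j x y * ginv g j k x y * w k x y)).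

Definition ext_d0 (f : field) : form1 := fun i => pd i f.
Definition ext_d1 (w : form1) : form2 := fun x y =>
  pd X1 (w X2) x y - pd X2 (w X1) x y.

Definition levi_civita (i j : idx) : R :=
  match i, j with
  | X1, X2 => 1
  | X2, X1 => -1
  | _, _ => 0
  end.

(** [star0] is not needed: [d^*] on functions is [0]. *)
Definition star1 (g : metric) (w : form1) : form1 := fun j x y =>
  sqrt (gdet g x y) *
  sum_idx (fun i => sum_idx (fun k =>
    levi_civita i j * ginv g i k x y * w k x y)).
Definition star2 (g : metric) (b : form2) : field := fun x y =>
  b x y / sqrt (gdet g x y).

(** [d^* = - * d *] on 1-forms and on 2-forms. *)
Definition codiff1 (g : metric) (w : form1) : field := fun x y =>
  - star2 g (ext_d1 (star1 g w)) x y.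
Definition codiff2 (g : metric) (b : form2) : form1 := fun i x y =>
  - star1 g (ext_d0 (star2 g b)) i x y.

(** The nonnegative operator [d d^* + d^* d]. *)
Definition hodge_laplacian (g : metric) (w : form1) : form1 := fun i x y =>
  ext_d0 (codiff1 g w) i x y + codiff2 g (ext_d1 w) i x y.

Definition polar_frame (a : R) (O e1 e2 : R3) (i : idx) (r th : R) : R3 :=
  ((pd i (fun s t => crd0 (polar_map a O e1 e2 s t)) r th,
    pd i (fun s t => crd1 (polar_map a O e1 e2 s t)) r th),
   pd i (fun s t => crd2 (polar_map a O e1 e2 s t)) r th).

Definition polar_metric (a : R) (O e1 e2 : R3) : metric := fun i j r th =>
  mink (polar_frame a O e1 e2 i r th) (polar_frame a O e1 e2 j r th).

(** [g] is the Riemannian metric in the chart [(r, theta)], in this order (which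
    is the positive orientation).  [u] has components with respect to [d/dr] and [d/dtheta]; the region [U] is
    meant to lie in the domain of the polar coordinates. *)
Definition satisfies_NS (a nu : R) (O e1 e2 : R3) (u : vfield)
    (U : R3 -> Prop) : Prop :=
  let g := polar_metric a O e1 e2 in
  let V := fun r th => polar_domain r th /\ U (polar_map a O e1 e2 r th) in
  exists P : R3 -> R,
    let Pc := fun r th => P (polar_map a O e1 e2 r th) in
    smooth_2d V Pc /\
    forall r th, V r th ->
      (forall i,
         nu * (hodge_laplacian g (flat g u) i r th - 2 * Ric g (flat g u) i r th)
         + flat g (nabla g u u) i r th + ext_d0 Pc i r th = 0) /\
      codiff1 g (flat g u) r th = 0.

(** The vector field [- Y(r) (a / sinh(a r)) d/dtheta]. *)
Definition parallel_flow (a : R) (Y : R -> R) : vfield := fun i r _ =>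
  match i with
  | X1 => 0
  | X2 => - Y r * (a / sinh (a * r))
  end.

Definition quadratic_profile (alpha1 alpha2 lambda : R) : R :=
  alpha1 * lambda - alpha2 / 2 * lambda ^ 2.

Definition angle_between (a : R) (O e1 e2 : R3) (tau : R) (p : R3) : Prop :=
  exists r th, polar_coord a O e1 e2 p r th /\ 0 < th < tau.

Definition arc (a : R) (O e1 e2 : R3) (delta tau : R) (p : R3) : Prop :=
  H2 a p /\ hyp_dist a p O = delta /\ angle_between a O e1 e2 tau p.

Definition sector (a : R) (O e1 e2 : R3) (delta tau eps0 : R) (p : R3) : Prop :=
  H2 a p /\ delta < hyp_dist a p O < delta + eps0 /\
  angle_between a O e1 e2 tau p.

Definition exterior_region (a : R) (O e1 e2 : R3) (delta tau : R) (p : R3) : Prop :=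
  H2 a p /\ delta < hyp_dist a p O /\ angle_between a O e1 e2 tau p.

Definition compact_set {T : UniformSpace} (K : T -> Prop) : Prop :=
  forall (I : Type) (U : I -> T -> Prop),
    (forall i, open (U i)) ->
    (forall x, K x -> exists i, U i x) ->
    exists l : list I, forall x, K x -> exists i, In i l /\ U i x.

Definition boundary_in {T : UniformSpace} (M K : T -> Prop) (p : T) : Prop :=
  M p /\
  forall V : T -> Prop, locally p V ->
    (exists q, V q /\ M q /\ K q) /\ (exists q, V q /\ M q /\ ~ K q).

(** A function on [[delta, oo)] is represented by a total function whose values
    below [delta] are irrelevant; derivatives at [delta] are one-sided. *)

Definition is_derive_within (D : R -> Prop) (f : R -> R) (x l : R) : Prop :=
  filterlim (fun y => (f y - f x) / (y - x)) (within D (locally' x)) (locally l).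

(** [Y] is smooth on [[delta, oo)], with [n]-th derivative [D n]. *)
Definition smooth_with_derivatives (delta : R) (Y : R -> R)
    (D : nat -> R -> R) : Prop :=
  (forall x, delta <= x -> D 0%nat x = Y x) /\
  forall n x, delta <= x ->
    is_derive_within (fun y => delta <= y) (D n) x (D (S n) x).

Definition smooth_with_initial_data (delta alpha1 alpha2 : R) (Y : R -> R) : Prop :=
  exists D : nat -> R -> R,
    smooth_with_derivatives delta Y D /\
    Y delta = 0 /\ D 1%nat delta = alpha1 /\ D 2%nat delta = - alpha2.

Definition analytic_from (delta : R) (Y : R -> R) : Prop :=
  forall x, delta <= x ->
    exists (c : nat -> R) (rho : R), 0 < rho /\
      forall y, delta <= y -> Rabs (y - x) < rho -> is_pseries c (y - x) (Y y).

(* Main.v *)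
(* In polar coordinates the metric is [dr^2 + s^2 dth^2] with [s = sinh (a r) / a], and for the flow
   [- Y / s d/dth] the momentum equation becomes [dP/dr = a coth (a r) Y^2] and
   [dP/dth = - nu F] with
   [F = s (Y'' + a coth (a r) Y' - (2 a^2 + a^2 / sinh (a r)^2) Y)] depending on [r] only. Since
   [dP/dr] does not depend on [th], such a [P] exists exactly when [F] is constant.
   For the quadratic profile [F'(delta) < 0], hence no pressure exists. For given initial data the
   constant is fixed by [Y''(delta)], so [Y] solves a linear second order equation, whose
   solution is explicit and analytic on [(0, oo)] and unique by Gronwall's inequality. *)

Require Import Defs.
From Stdlib Require Import Reals Lra Lia ClassicalEpsilon FunctionalExtensionality.
From Coquelicot Require Import Coquelicot.
Open Scope R_scope.

(** * The polar chart of the hyperboloid *)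

(** Two mismatches shape the proof. [satisfies_NS] speaks of a pressure on points of [R3], whereas
    the equations are solved in the chart: injectivity of [polar_map] turns a formula in [(r, th)]
    into a function of points, and the facts that its image lies on the upper sheet and that [r] is
    the distance to [O] show which chart points belong to a region. Moreover, a competing profile
    has only one-sided derivatives at [delta], while the system is known only for [r > delta]; the
    constant value of [F] therefore has to be carried to the end point by continuity before the
    initial data can identify it.

    The tensor calculus is done for a general metric [dr^2 + s(r)^2 dth^2] with [s'' = a^2 s], an
    equation that encodes curvature [- a^2].

    Analyticity is obtained on all of [(0, oo)] by closing local power series under sums, products,
    reciprocals and antiderivatives. It also yields every derivative of the profile and of the
    radial part of the pressure, so smoothness follows from it. *)

Lemma cosh_sinh_sq (x : R) : cosh x * cosh x = 1 + sinh x * sinh x.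
Proof.
  assert (E : exp x * exp (- x) = 1).
  { rewrite <- exp_plus, Rplus_opp_r. apply exp_0. }
  unfold cosh, sinh. nra.
Qed.

Lemma cosh_pos (x : R) : 0 < cosh x.
Proof. unfold cosh. pose proof (exp_pos x). pose proof (exp_pos (- x)). lra. Qed.

Lemma sinh_pos (x : R) : 0 < x -> 0 < sinh x.
Proof.
  intros Hx. unfold sinh.
  assert (exp (- x) < exp x) by (apply exp_increasing; lra). lra.
Qed.

Lemma arcosh_cosh (x : R) : 0 <= x -> arcosh (cosh x) = x.
Proof.
  intros Hx. unfold arcosh.
  assert (Hs : 0 <= sinh x).
  { destruct Hx as [Hx| <-]; [left; now apply sinh_pos|rewrite sinh_0; lra]. }
  replace (cosh x ^ 2 - 1) with (sinh x ^ 2) by (pose proof (cosh_sinh_sq x); nra).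
  rewrite sqrt_pow2 by easy.
  replace (cosh x + sinh x) with (exp x) by (unfold cosh, sinh; field).
  apply ln_exp.
Qed.

Section Polar.

Variables (a : R) (a_pos : 0 < a).
Variables (O e1 e2 : R3) (HO : H2 a O) (He : oriented_orthonormal_basis O e1 e2).

(** Expanded in coordinates instead of built from [plus] and [scal], so that [ring] and
    [auto_derive] meet plain real expressions. In the frame [O, e1, e2] the Minkowski form is
    diagonal with entries [- 1 / a^2, 1, 1]. *)
Definition frame_combination (c x y : R) : R3 :=
  ((c * crd0 O + x * crd0 e1 + y * crd0 e2, c * crd1 O + x * crd1 e1 + y * crd1 e2),
   c * crd2 O + x * crd2 e1 + y * crd2 e2).

Lemma mink_frame_combination (c x y c' x' y' : R) :
  mink (frame_combination c x y) (frame_combination c' x' y') =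
  - (c * c' / a ^ 2) + x * x' + y * y'.
Proof.
  destruct He as (HO1 & HO2 & H11 & H22 & H12 & _).
  destruct HO as [HOO _].
  transitivity (c * c' * mink O O + x * x' * mink e1 e1 + y * y' * mink e2 e2
    + (c * x' + x * c') * mink O e1 + (c * y' + y * c') * mink O e2
    + (x * y' + y * x') * mink e1 e2).
  - unfold mink, frame_combination, crd0, crd1, crd2; cbn. ring.
  - rewrite HO1, HO2, H11, H22, H12, HOO. field. lra.
Qed.

Lemma R3_ext (p q : R3) : crd0 p = crd0 q -> crd1 p = crd1 q -> crd2 p = crd2 q -> p = q.
Proof.
  destruct p as [[p0 p1] p2], q as [[q0 q1] q2]. unfold crd0, crd1, crd2; cbn.
  intros -> -> ->. easy.
Qed.

Lemma frame_combination_100 : frame_combination 1 0 0 = O.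
Proof. apply R3_ext; unfold frame_combination, crd0, crd1, crd2; cbn; ring. Qed.

(* The identity [sinh (a |r|) / (a |r|) * r = sinh (a r) / a] holds for [r <= 0] too, with the
   junk value [0 / 0 * 0 = 0] at [r = 0]. *)
Lemma polar_map_eq (r th : R) :
  polar_map a O e1 e2 r th =
  frame_combination (cosh (a * r)) (sinh (a * r) / a * cos th) (sinh (a * r) / a * sin th).
Proof.
  unfold polar_map, hyp_exp.
  replace (plus (scal (r * cos th) e1) (scal (r * sin th) e2))
    with (frame_combination 0 (r * cos th) (r * sin th)).
  2:{ apply R3_ext; unfold frame_combination, crd0, crd1, crd2; cbn;
      unfold mult, plus; cbn; ring. }
  assert (Hv : tangent_norm (frame_combination 0 (r * cos th) (r * sin th)) = Rabs r).
  { unfold tangent_norm. rewrite mink_frame_combination, <- sqrt_Rsqr_abs. f_equal.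
    pose proof (sin2_cos2 th) as T. unfold Rsqr in *.
    transitivity (r * r * (sin th * sin th + cos th * cos th)); [field; lra|].
    rewrite T; ring. }
  rewrite Hv.
  assert (Hc : cosh (a * Rabs r) = cosh (a * r)).
  { unfold Rabs; destruct (Rcase_abs r); [|easy]. unfold cosh.
    replace (a * - r) with (- (a * r)) by ring. rewrite Ropp_involutive. lra. }
  assert (Hs : sinh (a * Rabs r) / (a * Rabs r) * r = sinh (a * r) / a).
  { destruct (Req_dec r 0) as [->|Hr].
    - rewrite Rmult_0_r, !Rmult_0_r, sinh_0. unfold Rdiv; ring.
    - unfold Rabs; destruct (Rcase_abs r); [|field; lra]. unfold sinh.
      replace (a * - r) with (- (a * r)) by ring. rewrite Ropp_involutive. field; lra. }
  rewrite Hc, <- Hs. clear Hc Hv Hs.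
  set (q := sinh (a * Rabs r) / (a * Rabs r)).
  apply R3_ext; unfold frame_combination, crd0, crd1, crd2; cbn;
    unfold mult, plus; cbn; ring.
Qed.

(** The equation of the quadric is [cosh^2 - sinh^2 = 1]. The real content is the choice of sheet:
    the first coordinate is [X o0 + (S / a) w0], with [w] a unit tangent vector at [O], and the sign
    of [w0] is unknown. *)
Lemma polar_map_H2 (r th : R) : H2 a (polar_map a O e1 e2 r th).
Proof.
  set (X := cosh (a * r)); set (S := sinh (a * r)).
  assert (HX : X * X = 1 + S * S) by apply cosh_sinh_sq.
  assert (X0 : 0 < X) by apply cosh_pos.
  pose proof (sin2_cos2 th) as T; unfold Rsqr in T.
  rewrite polar_map_eq; fold X S. split.
  { rewrite mink_frame_combination.
    transitivity (- (X * X / a ^ 2) + S * S / a ^ 2 * (sin th * sin th + cos th * cos th));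
      [field; lra|].
    rewrite T, HX. field. lra. }
  pose proof (mink_frame_combination 0 (cos th) (sin th) 0 (cos th) (sin th)) as Hw.
  pose proof (mink_frame_combination 1 0 0 0 (cos th) (sin th)) as HOw.
  rewrite frame_combination_100 in HOw.
  destruct HO as [HOO HO0].
  replace (- (0 * 0 / a ^ 2) + cos th * cos th + sin th * sin th) with 1 in Hw
    by (rewrite <- T; field; lra).
  replace (- (1 * 0 / a ^ 2) + 0 * cos th + 0 * sin th) with 0 in HOw by (field; lra).
  replace (crd0 _) with (X * crd0 O + S / a * crd0 (frame_combination 0 (cos th) (sin th)))
    by (unfold frame_combination, crd0; cbn; ring).
  set (w := frame_combination 0 (cos th) (sin th)) in *.
  unfold mink in *.
  set (w0 := crd0 w) in *; set (w1 := crd1 w) in *; set (w2 := crd2 w) in *.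
  set (o0 := crd0 O) in *; set (o1 := crd1 O) in *; set (o2 := crd2 O) in *.
  (* Reverse Cauchy-Schwarz: [w0^2 <= a^2 o0^2 - 1]. *)
  assert (CS : (w0 * o0) * (w0 * o0) <= (w1 * w1 + w2 * w2) * (o1 * o1 + o2 * o2)).
  { replace (w0 * o0) with (o1 * w1 + o2 * w2) by lra.
    pose proof (Rle_0_sqr (o1 * w2 - o2 * w1)) as Q. unfold Rsqr in Q. nra. }
  replace (w1 * w1 + w2 * w2) with (1 + w0 * w0) in CS by lra.
  replace (o1 * o1 + o2 * o2) with (o0 * o0 - / a ^ 2) in CS by lra.
  assert (B : w0 * w0 <= (a * o0) * (a * o0) - 1).
  { assert (w0 * w0 * / a ^ 2 <= o0 * o0 - / a ^ 2) by nra.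
    replace (w0 * w0) with (a ^ 2 * (w0 * w0 * / a ^ 2)) by (field; lra).
    replace (a * o0 * (a * o0) - 1) with (a ^ 2 * (o0 * o0 - / a ^ 2)) by (field; lra).
    apply Rmult_le_compat_l; [nra|easy]. }
  (* Otherwise squaring gives [X^2 (a o0)^2 <= (X^2 - 1) w0^2 <= (X^2 - 1) ((a o0)^2 - 1)], which is
     impossible since [X^2 >= 1] and [a o0 > 0]. *)
  assert (P : 0 < X * (a * o0) + S * w0).
  { apply Rnot_le_lt. intros N.
    assert (0 < a * o0) by (apply Rmult_lt_0_compat; easy).
    assert (0 < X * (a * o0)) by (apply Rmult_lt_0_compat; easy).
    assert (Q : (X * (a * o0)) * (X * (a * o0)) <= (S * w0) * (S * w0)) by nra.
    replace ((S * w0) * (S * w0)) with ((X * X - 1) * (w0 * w0)) in Q by (rewrite HX; ring).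
    assert ((X * X - 1) * (w0 * w0) <= (X * X - 1) * ((a * o0) * (a * o0) - 1)).
    { apply Rmult_le_compat_l; [nra|easy]. }
    nra. }
  replace (X * o0 + S / a * w0) with ((X * (a * o0) + S * w0) / a) by (field; lra).
  apply Rdiv_lt_0_compat; easy.
Qed.

Lemma hyp_dist_polar_map (r th : R) :
  0 <= r -> hyp_dist a (polar_map a O e1 e2 r th) O = r.
Proof.
  intros Hr. unfold hyp_dist. rewrite polar_map_eq.
  rewrite <- frame_combination_100 at 1. rewrite mink_frame_combination.
  replace (- a ^ 2 * _) with (cosh (a * r)) by (field; lra).
  rewrite arcosh_cosh by nra. field; lra.
Qed.

Lemma polar_map_inj (r th r' th' : R) :
  polar_domain r th -> polar_domain r' th' ->
  polar_map a O e1 e2 r th = polar_map a O e1 e2 r' th' -> r = r' /\ th = th'.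
Proof.
  intros [Hr Hth] [Hr' Hth'] E.
  assert (Er : r = r').
  { rewrite <- (hyp_dist_polar_map r th), <- (hyp_dist_polar_map r' th'), E by lra. easy. }
  subst r'. split; [easy|].
  rewrite !polar_map_eq in E.
  set (s := sinh (a * r) / a) in *.
  assert (Hs : 0 < s) by (apply Rdiv_lt_0_compat; [apply sinh_pos; nra|easy]).
  assert (C : cos th = cos th').
  { apply Rmult_eq_reg_l with s; [|lra].
    apply (f_equal (fun p => mink p (frame_combination 0 1 0))) in E.
    rewrite !mink_frame_combination in E. unfold Rdiv in E. lra. }
  assert (D : sin th = sin th').
  { apply Rmult_eq_reg_l with s; [|lra].
    apply (f_equal (fun p => mink p (frame_combination 0 0 1))) in E.
    rewrite !mink_frame_combination in E. unfold Rdiv in E. lra. }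
  (* Equal sines and cosines give [cos (th - th') = 1]. The half difference lies strictly between
     [- PI] and [PI], where [sin] vanishes only at [0]. *)
  assert (Z : sin ((th - th') / 2) = 0).
  { assert (Q : cos (2 * ((th - th') / 2)) = 1).
    { replace (2 * ((th - th') / 2)) with (th - th') by field.
      rewrite cos_minus, C, D. pose proof (sin2_cos2 th'). unfold Rsqr in *; lra. }
    rewrite cos_2a_sin in Q. nra. }
  destruct (Rtotal_order th th') as [L|[L|L]]; [|easy|].
  - assert (0 < sin ((th' - th) / 2)) by (apply sin_gt_0; lra).
    replace ((th - th') / 2) with (- ((th' - th) / 2)) in Z by field.
    rewrite sin_neg in Z. lra.
  - assert (0 < sin ((th - th') / 2)) by (apply sin_gt_0; lra). lra.
Qed.

Lemma polar_map_sector (delta tau eps0 r th : R) :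
  0 < delta -> tau < 2 * PI -> delta < r < delta + eps0 -> 0 < th < tau ->
  polar_domain r th /\ sector a O e1 e2 delta tau eps0 (polar_map a O e1 e2 r th).
Proof.
  intros Hd Ht Hr Hth. assert (D : polar_domain r th) by (unfold polar_domain; lra).
  split; [easy|]. split; [apply polar_map_H2|]. split.
  - rewrite hyp_dist_polar_map; lra.
  - exists r, th. repeat split; easy || apply D.
Qed.

Lemma polar_map_exterior (delta tau r th : R) :
  0 < delta -> tau < 2 * PI -> delta < r -> 0 < th < tau ->
  polar_domain r th /\ exterior_region a O e1 e2 delta tau (polar_map a O e1 e2 r th).
Proof.
  intros Hd Ht Hr Hth. assert (D : polar_domain r th) by (unfold polar_domain; lra).
  split; [easy|]. split; [apply polar_map_H2|]. split.
  - rewrite hyp_dist_polar_map; lra.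
  - exists r, th. repeat split; easy || apply D.
Qed.

Lemma polar_frame_X1 (r th : R) :
  polar_frame a O e1 e2 X1 r th =
  frame_combination (a * sinh (a * r)) (cosh (a * r) * cos th) (cosh (a * r) * sin th).
Proof.
  assert (D : forall o x y, Derive (fun t =>
      cosh (a * t) * o + sinh (a * t) / a * cos th * x + sinh (a * t) / a * sin th * y) r =
      a * sinh (a * r) * o + cosh (a * r) * cos th * x + cosh (a * r) * sin th * y).
  { intros o x y. apply is_derive_unique.
    auto_derive; [easy|]. field. lra. }
  apply R3_ext; (etransitivity; [apply Derive_ext; intros t; rewrite polar_map_eq;
    reflexivity|apply D]).
Qed.

Lemma polar_frame_X2 (r th : R) :
  polar_frame a O e1 e2 X2 r th =
  frame_combination 0 (- (sinh (a * r) / a * sin th)) (sinh (a * r) / a * cos th).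
Proof.
  assert (D : forall o x y, Derive (fun t =>
      cosh (a * r) * o + sinh (a * r) / a * cos t * x + sinh (a * r) / a * sin t * y) th =
      0 * o + - (sinh (a * r) / a * sin th) * x + sinh (a * r) / a * cos th * y).
  { intros o x y. apply is_derive_unique. auto_derive; [easy|]. field. lra. }
  apply R3_ext; (etransitivity; [apply Derive_ext; intros t; rewrite polar_map_eq;
    reflexivity|apply D]).
Qed.

Definition warped_metric (s : R -> R) : metric := fun i j r _ =>
  match i, j with
  | X1, X1 => 1
  | X2, X2 => s r ^ 2
  | _, _ => 0
  end.

Lemma polar_metric_eq :
  polar_metric a O e1 e2 = warped_metric (fun r => sinh (a * r) / a).
Proof.
  extensionality i; extensionality j; extensionality r; extensionality th.
  unfold polar_metric.
  pose proof (cosh_sinh_sq (a * r)) as HX.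
  pose proof (sin2_cos2 th) as T; unfold Rsqr in T.
  destruct i, j; rewrite ?polar_frame_X1, ?polar_frame_X2, mink_frame_combination;
    unfold warped_metric.
  - transitivity (- (sinh (a * r) * sinh (a * r))
      + cosh (a * r) * cosh (a * r) * (sin th * sin th + cos th * cos th)); [field; lra|].
    rewrite T, HX. ring.
  - field; lra.
  - field; lra.
  - transitivity ((sinh (a * r) / a) ^ 2 * (sin th * sin th + cos th * cos th)); [field; lra|].
    rewrite T. ring.
Qed.

End Polar.

(** * Circular fields in a warped metric *)

Lemma locally_gt (c x : R) : c < x -> locally x (fun t => c < t).
Proof. apply (open_gt c). Qed.

Section WarpedNavierStokes.

Variables (a : R) (s s1 : R -> R).
Hypothesis s_pos : forall r, 0 < r -> 0 < s r.
Hypothesis is_derive_s : forall r, 0 < r -> is_derive s r (s1 r).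
Hypothesis is_derive_s1 : forall r, 0 < r -> is_derive s1 r (a ^ 2 * s r).

Let g := warped_metric s.

Lemma Derive_s (r : R) : 0 < r -> Derive (fun t => s t) r = s1 r.
Proof. intros Hr. now apply is_derive_unique, is_derive_s. Qed.

Lemma Derive_s1 (r : R) : 0 < r -> Derive (fun t => s1 t) r = a ^ 2 * s r.
Proof. intros Hr. now apply is_derive_unique, is_derive_s1. Qed.

Lemma ex_derive_s (r : R) : 0 < r -> ex_derive (fun t => s t) r.
Proof. intros Hr. eexists. now apply is_derive_s. Qed.

Lemma ex_derive_s1 (r : R) : 0 < r -> ex_derive (fun t => s1 t) r.
Proof. intros Hr. eexists. now apply is_derive_s1. Qed.

Lemma s_neq0 (r : R) : 0 < r -> s r <> 0.
Proof. intros Hr. now apply Rgt_not_eq, s_pos. Qed.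

Hint Resolve s_neq0 ex_derive_s ex_derive_s1 : warped.

Definition warped_christoffel (k i j : idx) (r : R) : R :=
  match k, i, j with
  | X1, X2, X2 => - (s r * s1 r)
  | X2, X1, X2 | X2, X2, X1 => s1 r / s r
  | _, _, _ => 0
  end.

Lemma christoffel_warped (k i j : idx) (r th : R) :
  0 < r -> christoffel g k i j r th = warped_christoffel k i j r.
Proof.
  intros Hr.
  assert (E : Derive (fun t => s t ^ 2) r = 2 * s r * s1 r).
  { apply is_derive_unique. auto_derive; [auto with warped|]. rewrite Derive_s by easy. ring. }
  pose proof (s_neq0 r Hr).
  destruct k, i, j; unfold christoffel, sum_idx, ginv, gdet, pd, g, warped_metric, warped_christoffel;
    cbn -[pow]; rewrite ?Derive_const, ?E; field; easy.
Qed.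

(** The closed form of the symbols is available only for [r > 0]; this condition is open, so the
    substitution under the radial derivative is legitimate. *)
Lemma pd_christoffel_warped (l k i j : idx) (r th : R) :
  0 < r ->
  pd l (christoffel g k i j) r th =
  match l with X1 => Derive (warped_christoffel k i j) r | X2 => 0 end.
Proof.
  intros Hr. destruct l; cbn.
  - apply Derive_ext_loc. generalize (locally_gt 0 r Hr). apply filter_imp.
    intros t Ht. now apply christoffel_warped.
  - rewrite (Derive_ext _ (fun _ => warped_christoffel k i j r)).
    + apply Derive_const.
    + intros t. now apply christoffel_warped.
Qed.

(** The Gaussian curvature of [dr^2 + s^2 dth^2] is [- s'' / s], here [- a^2]. *)
Lemma ricci_warped (i j : idx) (r th : R) : 0 < r -> ricci g i j r th = - a ^ 2 * g i j r th.
Proof.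
  intros Hr.
  assert (E1 : Derive (fun t => s1 t / s t) r = a ^ 2 - (s1 r / s r) ^ 2).
  { apply is_derive_unique. auto_derive; [auto with warped|].
    rewrite Derive_s, Derive_s1 by easy. field. auto with warped. }
  assert (E2 : Derive (fun t => - (s t * s1 t)) r = - (s1 r * s1 r + a ^ 2 * s r * s r)).
  { apply is_derive_unique. auto_derive; [auto with warped|].
    rewrite Derive_s, Derive_s1 by easy. ring. }
  pose proof (s_neq0 r Hr).
  destruct i, j; unfold ricci, sum_idx; rewrite !pd_christoffel_warped, !christoffel_warped by easy;
    unfold warped_christoffel, g, warped_metric;
    rewrite ?E1, ?E2, ?Derive_const; field; easy.
Qed.

Lemma Ric_warped (w : Defs.form1) (i : idx) (r th : R) :
  0 < r -> Ric g w i r th = - a ^ 2 * w i r th.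
Proof.
  intros Hr. pose proof (s_neq0 r Hr).
  unfold Ric, sum_idx. rewrite !ricci_warped by easy.
  destruct i; unfold ginv, gdet, g, warped_metric; field; easy.
Qed.

Section Circular.

Variables (v : R -> R).

Definition circular_field : vfield := fun i r _ =>
  match i with X1 => 0 | X2 => v r end.

Lemma flat_circular (i : idx) (r th : R) :
  flat g circular_field i r th = match i with X1 => 0 | X2 => s r ^ 2 * v r end.
Proof.
  destruct i; unfold flat, sum_idx, circular_field, g, warped_metric; ring.
Qed.

(** This is the centripetal acceleration: the convective term reduces to the symbol [- s s1] of
    index [X1, X2, X2] times [v^2]. *)
Lemma flat_nabla_circular (i : idx) (r th : R) : 0 < r ->
  flat g (nabla g circular_field circular_field) i r th =
  match i with X1 => - (s r * s1 r * v r ^ 2) | X2 => 0 end.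
Proof.
  intros Hr. pose proof (s_neq0 r Hr).
  destruct i; unfold flat, nabla, sum_idx; rewrite !christoffel_warped by easy;
    unfold circular_field, g, warped_metric, warped_christoffel, pd;
    rewrite ?Derive_const; field; easy.
Qed.

(** The Hodge dual of the 1-form has only a [dr] component, which is independent of the angle, so it
    is closed. As the identity holds at every point, [d d^*] vanishes in the Hodge Laplacian
    below. *)
Lemma codiff1_circular (r th : R) : codiff1 g (flat g circular_field) r th = 0.
Proof.
  unfold codiff1, star2, ext_d1, pd.
  rewrite (Derive_ext _ (fun _ => 0)).
  2:{ intros t. unfold star1, sum_idx. rewrite !flat_circular.
      unfold levi_civita, ginv, g, warped_metric. unfold Rdiv. ring. }
  rewrite (Derive_ext (fun t => star1 g _ X1 r t) (fun _ => star1 g (flat g circular_field) X1 r 0)).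
  2:{ intros t. unfold star1, sum_idx. now rewrite !flat_circular. }
  rewrite !Derive_const. unfold Rdiv. ring.
Qed.

Lemma sqrt_gdet_warped (r th : R) : 0 < r -> sqrt (gdet g r th) = s r.
Proof.
  intros Hr. unfold gdet, g, warped_metric.
  replace (1 * s r ^ 2 - 0 * 0) with (s r ^ 2) by ring.
  apply sqrt_pow2. left. now apply s_pos.
Qed.

(** Only [d^* d] survives. The function [phi] is the vorticity; it depends on [r] alone, and the
    dual of [dr] is [s dth]. *)
Lemma hodge_laplacian_circular (i : idx) (r th : R) : 0 < r ->
  hodge_laplacian g (flat g circular_field) i r th =
  match i with
  | X1 => 0
  | X2 => - s r * Derive (fun t => Derive (fun q => s q ^ 2 * v q) t / s t) r
  end.
Proof.
  intros Hr. pose proof (s_neq0 r Hr).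
  assert (E : forall t y, ext_d1 (flat g circular_field) t y = Derive (fun q => s q ^ 2 * v q) t).
  { intros t y. unfold ext_d1, pd.
    rewrite (Derive_ext (fun q => flat g circular_field X2 q y) (fun q => s q ^ 2 * v q))
      by (intros q; apply flat_circular).
    rewrite (Derive_ext (fun q => flat g circular_field X1 t q) (fun q => 0))
      by (intros q; apply flat_circular).
    rewrite Derive_const. apply Rminus_0_r. }
  set (phi := fun t => Derive (fun q => s q ^ 2 * v q) t / s t).
  assert (D : forall j, ext_d0 (star2 g (ext_d1 (flat g circular_field))) j r th =
    match j with X1 => Derive phi r | X2 => 0 end).
  { intros [|]; unfold ext_d0, pd.
    - apply Derive_ext_loc. generalize (locally_gt 0 r Hr). apply filter_imp.
      intros t Ht. unfold star2. now rewrite E, sqrt_gdet_warped.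
    - rewrite (Derive_ext _ (fun _ => phi r)).
      + apply Derive_const.
      + intros t. unfold star2. now rewrite E, sqrt_gdet_warped. }
  unfold hodge_laplacian.
  replace (ext_d0 (codiff1 g (flat g circular_field)) i r th) with 0.
  - unfold codiff2, star1, sum_idx. rewrite !D, sqrt_gdet_warped by easy.
    unfold gdet, g, warped_metric, ginv, gdet, levi_civita. destruct i; field; easy.
  - symmetry. destruct i; unfold ext_d0, pd;
      (rewrite (Derive_ext _ (fun _ => 0)) by (intros t; apply codiff1_circular));
      apply Derive_const.
Qed.

End Circular.

(** Differentiability is asked only beyond [lo]: later [lo = 0] serves the explicit profile, and
    [lo = delta] a competitor known only on [[delta, oo)]. *)
Lemma hodge_circular_profile (Y Y1 Y2 : R -> R) (lo r : R) :
  0 <= lo -> lo < r ->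
  (forall x, lo < x -> is_derive Y x (Y1 x)) ->
  (forall x, lo < x -> is_derive Y1 x (Y2 x)) ->
  Derive (fun t => Derive (fun q => s q ^ 2 * (- Y q / s q)) t / s t) r =
  - (Y2 r + s1 r / s r * Y1 r + (a ^ 2 - (s1 r / s r) ^ 2) * Y r).
Proof.
  intros Hlo Hr D1 D2.
  assert (exY : forall t, lo < t -> ex_derive (fun t => Y t) t).
  { intros t Ht. eexists. now apply D1. }
  assert (exY1 : forall t, lo < t -> ex_derive (fun t => Y1 t) t).
  { intros t Ht. eexists. now apply D2. }
  assert (DY : forall t, lo < t -> Derive (fun t => Y t) t = Y1 t).
  { intros t Ht. now apply is_derive_unique, D1. }
  assert (DY1 : forall t, lo < t -> Derive (fun t => Y1 t) t = Y2 t).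
  { intros t Ht. now apply is_derive_unique, D2. }
  assert (F : forall t, lo < t ->
    Derive (fun q => s q ^ 2 * (- Y q / s q)) t = - (s1 t * Y t + s t * Y1 t)).
  { intros t Ht. assert (Ht0 : 0 < t) by lra. pose proof (s_neq0 t Ht0).
    apply is_derive_unique. auto_derive; [auto 6 with warped|].
    rewrite Derive_s, DY by easy. field. easy. }
  assert (Hr0 : 0 < r) by lra. pose proof (s_neq0 r Hr0).
  rewrite (Derive_ext_loc _ (fun t => - (s1 t / s t * Y t + Y1 t))).
  - apply is_derive_unique. auto_derive; [auto 8 with warped|].
    rewrite Derive_s, Derive_s1, DY, DY1 by easy. field. easy.
  - generalize (locally_gt lo r Hr). apply filter_imp.
    intros t Ht. rewrite F by easy. field. apply s_neq0. lra.
Qed.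

End WarpedNavierStokes.

(** * Existence of a pressure *)

(** This is [F] of the overview. The derivatives are separate arguments, so that the one-sided
    derivatives of a function on [[delta, oo)] can be inserted. *)
Definition azimuthal_force (a : R) (Y Y1 Y2 : R -> R) (r : R) : R :=
  sinh (a * r) / a * Y2 r + cosh (a * r) * Y1 r
  - (2 * a * sinh (a * r) + a / sinh (a * r)) * Y r.

Lemma constant_of_is_derive_0 (f : R -> R) (x y : R) :
  (forall t, Rmin x y <= t <= Rmax x y -> is_derive f t 0) -> f x = f y.
Proof.
  intros D. destruct (Rtotal_order x y) as [H|[->|H]]; [|easy|].
  - apply (eq_is_derive f x y); [|easy].
    intros t Ht. apply D. now rewrite Rmin_left, Rmax_right by lra.
  - symmetry. apply (eq_is_derive f y x); [|easy].
    intros t Ht. apply D. now rewrite Rmin_right, Rmax_left by lra.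
Qed.

Lemma continuity_2d_pt_fst (phi : R -> R) (x y : R) :
  continuity_pt phi x -> continuity_2d_pt (fun u _ => phi u) x y.
Proof.
  intros H eps.
  destruct (proj1 (continuity_pt_locally phi x) H eps) as [d Hd].
  exists d. intros u v Hu _. now apply Hd.
Qed.

(** The first hypothesis says that [U] is open, which makes partial derivatives agree on [U] as soon
    as the functions do. The pressure in the chart matches its formula only on the polar domain. *)
Lemma Ck_ext (U : R -> R -> Prop) (k : nat) (f g : R -> R -> R) :
  (forall x y, U x y -> locally_2d U x y) ->
  (forall x y, U x y -> f x y = g x y) -> Ck k U f -> Ck k U g.
Proof.
  intros HU. revert f g. induction k as [|k IH]; intros f g E [Hc Hd].
  - split; [|easy]. intros x y Hxy. apply (continuity_2d_pt_ext_loc f); [|now apply Hc].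
    generalize (HU x y Hxy). apply locally_2d_impl, locally_2d_forall. intros; now apply E.
  - split.
    + intros x y Hxy. apply (continuity_2d_pt_ext_loc f); [|now apply Hc].
      generalize (HU x y Hxy). apply locally_2d_impl, locally_2d_forall. intros; now apply E.
    + assert (L1 : forall x y, U x y -> locally x (fun t => f t y = g t y)).
      { intros x y Hxy. destruct (HU x y Hxy) as [d Hd']. exists d. intros t Ht.
        apply E, Hd'; [apply Ht|]. rewrite Rminus_eq_0, Rabs_R0. apply cond_pos. }
      assert (L2 : forall x y, U x y -> locally y (fun t => f x t = g x t)).
      { intros x y Hxy. destruct (HU x y Hxy) as [d Hd']. exists d. intros t Ht.
        apply E, Hd'; [|apply Ht]. rewrite Rminus_eq_0, Rabs_R0. apply cond_pos. }
      intros i. destruct (Hd i) as [He Hk]. split.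
      * intros x y Hxy. specialize (He x y Hxy). destruct i; cbn in *.
        -- apply (ex_derive_ext_loc (fun t => f t y)); [now apply L1|easy].
        -- apply (ex_derive_ext_loc (fun t => f x t)); [now apply L2|easy].
      * apply (IH (pd i f)); [|easy]. intros x y Hxy. destruct i; cbn.
        -- apply Derive_ext_loc; now apply L1.
        -- apply Derive_ext_loc; now apply L2.
Qed.

Lemma Ck_const (U : R -> R -> Prop) (k : nat) (c : R) : Ck k U (fun _ _ => c).
Proof.
  revert c. induction k as [|k IH]; intros c; split; try easy.
  - intros x y _. apply continuity_2d_pt_const.
  - intros x y _. apply continuity_2d_pt_const.
  - intros i. split.
    + intros x y _. destruct i; cbn; auto_derive; easy.
    + replace (pd i (fun _ _ => c)) with (fun _ _ : R => 0); [apply IH|].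
      extensionality x; extensionality y. destruct i; cbn; now rewrite Derive_const.
Qed.

(** This is the shape of the pressure. Radial differentiation keeps the shape, with [c = 0], and
    angular differentiation leaves a constant, so induction on [k] goes through. *)
Lemma Ck_radial_plus_angular (U : R -> R -> Prop) (k : nat) (phi : R -> R) (c : R) :
  (forall n x y, U x y -> ex_derive_n phi n x) ->
  Ck k U (fun x y => phi x + c * y).
Proof.
  revert phi c. induction k as [|k IH]; intros phi c H.
  all: assert (C : forall x y, U x y -> continuity_2d_pt (fun x y => phi x + c * y) x y).
  1,3: intros x y Hxy; apply continuity_2d_pt_plus;
    [apply continuity_2d_pt_fst, continuity_pt_filterlim, (ex_derive_continuous phi), (H 1%nat x y Hxy)
    |apply continuity_2d_pt_mult; [apply continuity_2d_pt_const|apply continuity_2d_pt_id2]].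
  - easy.
  - split; [easy|]. intros [|]; split.
    + intros x y Hxy. cbn. apply (ex_derive_plus phi); [apply (H 1%nat x y Hxy)|apply ex_derive_const].
    + replace (pd X1 (fun x y => phi x + c * y)) with (fun x y => Derive phi x + 0 * y).
      * apply IH. intros n x y Hxy. specialize (H (S n) x y Hxy).
        destruct n as [|n]; [easy|]. cbn in *.
        apply (ex_derive_ext (Derive_n phi (S n))); [|easy].
        intros t. change (Derive_n phi (S n) t = Derive_n (Derive_n phi 1) n t).
          now rewrite Derive_n_comp, Nat.add_1_r.
      (* The equality is needed at all [x], even where [phi] may fail to be differentiable; it holds
         because the difference quotients coincide. *)
      * extensionality x; extensionality y. cbn. unfold Derive.
        rewrite Rmult_0_l, Rplus_0_r. f_equal. apply Lim_ext. intros h. f_equal. ring.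
    + intros x y Hxy. cbn. auto_derive. easy.
    + replace (pd X2 (fun x y => phi x + c * y)) with (fun _ _ : R => c); [apply Ck_const|].
      extensionality x; extensionality y. cbn. symmetry. apply is_derive_unique.
      auto_derive; [easy|ring].
Qed.

Lemma polar_domain_open (x y : R) : polar_domain x y -> locally_2d polar_domain x y.
Proof.
  intros [Hx [Hy1 Hy2]].
  assert (Hd : 0 < Rmin x (Rmin y (2 * PI - y))).
  { repeat apply Rmin_glb_lt; lra. }
  exists (mkposreal _ Hd). cbn. intros u v Hu Hv.
  pose proof (Rmin_l x (Rmin y (2 * PI - y))). pose proof (Rmin_r x (Rmin y (2 * PI - y))).
  pose proof (Rmin_l y (2 * PI - y)). pose proof (Rmin_r y (2 * PI - y)).
  apply Rabs_def2 in Hu. apply Rabs_def2 in Hv. unfold polar_domain. lra.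
Qed.

Lemma Ck_subset (U V : R -> R -> Prop) (k : nat) (f : R -> R -> R) :
  (forall x y, V x y -> U x y) -> Ck k U f -> Ck k V f.
Proof.
  intros HV. revert f. induction k as [|k IH]; intros f [Hc Hd]; split; auto.
  intros i. destruct (Hd i). split; auto.
Qed.

(** * The Navier-Stokes system for a parallel laminar flow *)

Section ParallelFlow.

Variables (a nu : R) (a_pos : 0 < a) (nu_pos : 0 < nu).
Variables (O e1 e2 : R3) (HO : H2 a O) (He : oriented_orthonormal_basis O e1 e2).

Let g := polar_metric a O e1 e2.

Lemma parallel_flow_circular (Y : R -> R) :
  parallel_flow a Y = circular_field (fun r => - Y r / (sinh (a * r) / a)).
Proof.
  extensionality i; extensionality r; extensionality th. destruct i; cbn; [easy|].
  unfold Rdiv. rewrite Rinv_mult, Rinv_inv. ring.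
Qed.

Lemma codiff1_parallel_flow (Y : R -> R) (r th : R) :
  codiff1 g (flat g (parallel_flow a Y)) r th = 0.
Proof.
  unfold g. rewrite (polar_metric_eq a), parallel_flow_circular by assumption.
  apply codiff1_circular.
Qed.

Lemma momentum_parallel_flow (Y Y1 Y2 : R -> R) (lo r th : R) (i : idx) :
  0 <= lo -> lo < r ->
  (forall x, lo < x -> is_derive Y x (Y1 x)) ->
  (forall x, lo < x -> is_derive Y1 x (Y2 x)) ->
  nu * (hodge_laplacian g (flat g (parallel_flow a Y)) i r th
        - 2 * Ric g (flat g (parallel_flow a Y)) i r th)
  + flat g (nabla g (parallel_flow a Y) (parallel_flow a Y)) i r th =
  match i with
  | X1 => - (a * cosh (a * r) / sinh (a * r) * Y r ^ 2)
  | X2 => nu * azimuthal_force a Y Y1 Y2 r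
  end.
Proof.
  intros Hlo Hr D1 D2.
  unfold g. rewrite (polar_metric_eq a), parallel_flow_circular by assumption.
  set (s := fun r => sinh (a * r) / a).
  assert (Hs : forall t, 0 < t -> 0 < s t).
  { intros t Ht. apply Rdiv_lt_0_compat; [apply sinh_pos; nra|easy]. }
  assert (Ds : forall t, 0 < t -> is_derive s t (cosh (a * t))).
  { intros t _. unfold s. auto_derive; [easy|field; lra]. }
  assert (Ds1 : forall t, 0 < t -> is_derive (fun r => cosh (a * r)) t (a ^ 2 * s t)).
  { intros t _. unfold s. auto_derive; [easy|field; lra]. }
  assert (Hr0 : 0 < r) by lra. specialize (Hs r Hr0) as Hsr.
  change (fun r => - Y r / (sinh (a * r) / a)) with (fun r => - Y r / s r).
  assert (S0 : 0 < sinh (a * r)) by (apply sinh_pos; nra).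
  set (s1 := fun r => cosh (a * r)) in *.
  rewrite (hodge_laplacian_circular s Hs), (Ric_warped a s s1 Hs Ds Ds1),
    (flat_nabla_circular s s1 Hs Ds), flat_circular by easy.
  destruct i.
  - unfold s, s1 in *. field. lra.
  - rewrite (hodge_circular_profile a s s1 Hs Ds Ds1 Y Y1 Y2 lo) by easy.
    unfold azimuthal_force, s, s1 in *. pose proof (cosh_sinh_sq (a * r)) as E.
    (* The Laplacian contributes [a^2 - a^2 coth^2] to the coefficient of [Y] and the Ricci term
       [- 2 a^2]. Replacing [cosh^2] by [1 + sinh^2] gives the form in [azimuthal_force]. *)
    transitivity (nu * (sinh (a * r) / a * Y2 r + cosh (a * r) * Y1 r
      - (a * sinh (a * r) + a * (cosh (a * r) * cosh (a * r)) / sinh (a * r)) * Y r)).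
    + field. lra.
    + rewrite E. field. lra.
Qed.

(** First derivatives of the pressure suffice. On a circle [dP/dth] is the constant [- nu F(r)], so
    the increment of [P] between two fixed angles is a nonzero multiple of [F(r)]; this increment
    does not vary with [r], because [dP/dr] is the same at both angles. *)
Lemma azimuthal_force_constant (Y Y1 Y2 : R -> R) (U : R3 -> Prop) (lo hi tau : R) :
  0 <= lo -> 0 < tau ->
  (forall r th, lo < r < hi -> 0 < th < tau ->
     polar_domain r th /\ U (polar_map a O e1 e2 r th)) ->
  (forall x, lo < x -> is_derive Y x (Y1 x)) ->
  (forall x, lo < x -> is_derive Y1 x (Y2 x)) ->
  satisfies_NS a nu O e1 e2 (parallel_flow a Y) U ->
  forall r r', lo < r < hi -> lo < r' < hi ->
    azimuthal_force a Y Y1 Y2 r = azimuthal_force a Y Y1 Y2 r'.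
Proof.
  intros Hlo Htau HU D1 D2 (P & HP & NS).
  set (Pc := fun r th => P (polar_map a O e1 e2 r th)) in *.
  destruct (HP 1%nat) as [_ HP1]. clear HP. fold g in NS.
  set (F := azimuthal_force a Y Y1 Y2).
  assert (E1 : forall r th, lo < r < hi -> 0 < th < tau ->
    is_derive (fun t => Pc t th) r (a * cosh (a * r) / sinh (a * r) * Y r ^ 2)).
  { intros r th Hr Hth. specialize (HU r th Hr Hth). destruct (HP1 X1) as [Hex _].
    specialize (Hex r th HU). apply Derive_correct in Hex.
    destruct (NS r th HU) as [M _]. specialize (M X1).
    rewrite (momentum_parallel_flow Y Y1 Y2 lo) in M by (lra || assumption).
    unfold ext_d0, pd in M.
    replace (a * cosh (a * r) / sinh (a * r) * Y r ^ 2) with (Derive (fun t => Pc t th) r) by lra.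
    easy. }
  assert (E2 : forall r th, lo < r < hi -> 0 < th < tau ->
    is_derive (fun t => Pc r t) th (- nu * F r)).
  { intros r th Hr Hth. specialize (HU r th Hr Hth). destruct (HP1 X2) as [Hex _].
    specialize (Hex r th HU). apply Derive_correct in Hex.
    destruct (NS r th HU) as [M _]. specialize (M X2).
    rewrite (momentum_parallel_flow Y Y1 Y2 lo) in M by (lra || assumption).
    unfold ext_d0, pd in M. fold F in M.
    replace (- nu * F r) with (Derive (fun t => Pc r t) th) by lra.
    easy. }
  (* Two angles inside [(0, tau)], so that the whole closed interval between them stays in the
     region. *)
  set (t1 := tau / 3). set (t2 := 2 * tau / 3).
  assert (Q : forall r, lo < r < hi -> Pc r t2 - Pc r t1 = - nu * F r * (tau / 3)).
  { intros r Hr.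
    assert (C : Pc r t1 + nu * F r * t1 = Pc r t2 + nu * F r * t2).
    { apply (constant_of_is_derive_0 (fun t => Pc r t + nu * F r * t)).
      intros t Ht. unfold t1, t2 in Ht. rewrite Rmin_left, Rmax_right in Ht by lra.
      replace 0 with (- nu * F r + nu * F r) by ring.
      apply (is_derive_plus (fun t => Pc r t)).
      - apply E2; lra.
      - auto_derive; [easy|ring]. }
    unfold t1, t2 in *. lra. }
  intros r r' Hr Hr'.
  assert (C : Pc r t2 - Pc r t1 = Pc r' t2 - Pc r' t1).
  { apply (constant_of_is_derive_0 (fun x => Pc x t2 - Pc x t1)).
    intros x Hx. assert (lo < x < hi).
    { destruct Hx as [Hx Hx']. split.
      - apply Rlt_le_trans with (2 := Hx). now apply Rmin_glb_lt.
      - apply Rle_lt_trans with (1 := Hx'). now apply Rmax_lub_lt. }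
    replace 0 with (a * cosh (a * x) / sinh (a * x) * Y x ^ 2
      - a * cosh (a * x) / sinh (a * x) * Y x ^ 2) by ring.
    apply (is_derive_minus (fun x => Pc x t2)); apply E1; unfold t1, t2; lra. }
  rewrite !Q in C by easy. fold F.
  apply Rmult_eq_reg_l with (nu * (tau / 3)); [lra|]. apply Rgt_not_eq. nra.
Qed.

Lemma satisfies_NS_of_constant_force (Y Y1 Y2 G : R -> R) (C : R) (U : R3 -> Prop) :
  (forall x, 0 < x -> is_derive Y x (Y1 x)) ->
  (forall x, 0 < x -> is_derive Y1 x (Y2 x)) ->
  (forall x, 0 < x -> azimuthal_force a Y Y1 Y2 x = C) ->
  (forall n x, 0 < x -> ex_derive_n G n x) ->
  (forall x, 0 < x -> is_derive G x (a * cosh (a * x) / sinh (a * x) * Y x ^ 2)) ->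
  satisfies_NS a nu O e1 e2 (parallel_flow a Y) U.
Proof.
  intros D1 D2 HC HG DG.
  (* The inverse chart, by choice; [polar_map_inj] makes its value unambiguous. The term linear in
     [th] is a function of points because the polar domain restricts [th] to [(0, 2 PI)]. *)
  set (coord := fun p => epsilon (inhabits (0, 0))
    (fun c : R * R => polar_domain (fst c) (snd c) /\ p = polar_map a O e1 e2 (fst c) (snd c))).
  set (P := fun p : R3 => G (fst (coord p)) + - nu * C * snd (coord p)).
  assert (EP : forall r th, polar_domain r th ->
    G r + - nu * C * th = P (polar_map a O e1 e2 r th)).
  { intros r th Hd. unfold P.
    assert (E : coord (polar_map a O e1 e2 r th) = (r, th)).
    { unfold coord. match goal with |- epsilon ?i ?Q = _ =>
        pose proof (epsilon_spec i Q) as S; set (c := epsilon i Q) in * end.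
      destruct S as [Hd' Hm]; [now exists (r, th)|]. clearbody c.
      apply (polar_map_inj a a_pos O e1 e2 HO He) in Hm; [|easy..].
      destruct Hm as [-> ->]. now destruct c. }
    now rewrite E. }
  exists P. fold g. split.
  (* Regularity is proved on the whole polar domain, which is open, and then restricted to the part
     lying over the arbitrary set [U]. *)
  - intros k. apply (Ck_subset polar_domain); [now intros x y []|].
    apply (Ck_ext _ _ (fun r th => G r + - nu * C * th)).
    + apply polar_domain_open.
    + apply EP.
    + apply Ck_radial_plus_angular. intros n x y [Hx _]. now apply HG.
  - intros r th [Hd _]. split; [|apply codiff1_parallel_flow].
    intros i. rewrite (momentum_parallel_flow Y Y1 Y2 0) by (apply Hd || assumption || lra).
    destruct (polar_domain_open r th Hd) as [d Hd'].
    destruct Hd as [Hr Hth]. destruct i; unfold ext_d0, pd.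
    + rewrite (Derive_ext_loc _ (fun t => G t + - nu * C * th)).
      * rewrite (is_derive_unique _ _ (a * cosh (a * r) / sinh (a * r) * Y r ^ 2)); [ring|].
        rewrite <- Rplus_0_r.
        apply (is_derive_plus G); [now apply DG|apply (is_derive_const (V := R_NormedModule))].
      * exists d. intros t Ht. symmetry. apply EP, Hd'; [apply Ht|].
        rewrite Rminus_eq_0, Rabs_R0. apply cond_pos.
    + rewrite (Derive_ext_loc _ (fun t => G r + - nu * C * t)).
      * rewrite (is_derive_unique _ _ (- nu * C)); [rewrite HC by easy; ring|].
        auto_derive; [easy|ring].
      * exists d. intros t Ht. symmetry. apply EP, Hd'; [|apply Ht].
        rewrite Rminus_eq_0, Rabs_R0. apply cond_pos.
Qed.

End ParallelFlow.

(** * Real-analytic functions *)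

Lemma pseries_terms_bounded (c : nat -> R) (t : R) :
  ex_pseries c t -> exists M, 0 < M /\ forall n, Rabs (c n * t ^ n) <= M.
Proof.
  intros [l Hl]. apply is_pseries_R in Hl.
  assert (L : is_lim_seq (fun n => c n * t ^ n) 0) by (apply ex_series_lim_0; now exists l).
  destruct (filterlim_bounded (K := R_AbsRing) (V := R_NormedModule) (fun n => c n * t ^ n)) as [M HM].
  { now exists 0. }
  exists (Rabs M + 1). split; [pose proof (Rabs_pos M); lra|].
  intros n. apply Rle_trans with M; [apply HM|]. pose proof (Rle_abs M). lra.
Qed.

(** Terms are bounded at the midpoint between [Rabs t] and [rho], which pushes the radius strictly
    beyond [Rabs t], as Cauchy products and termwise differentiation require. *)
Lemma CV_radius_gt_of_ex_pseries (c : nat -> R) (rho t : R) :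
  (forall t, Rabs t < rho -> ex_pseries c t) -> Rabs t < rho -> Rbar_lt (Rabs t) (CV_radius c).
Proof.
  intros H Ht. apply Rbar_lt_le_trans with ((Rabs t + rho) / 2); [cbn; lra|].
  apply (proj1 (CV_radius_bounded c)).
  destruct (pseries_terms_bounded c ((Rabs t + rho) / 2)) as (M & _ & HM).
  - apply H. pose proof (Rabs_pos t). rewrite Rabs_pos_eq; lra.
  - now exists M.
Qed.

(** Two-sided, unlike [analytic_from]: the explicit profile is analytic on a neighbourhood of
    [[delta, oo)], and the one-sided notion follows by restriction. *)
Definition analytic_at (f : R -> R) (x : R) : Prop :=
  exists (c : nat -> R) (rho : R), 0 < rho /\
    forall y, Rabs (y - x) < rho -> is_pseries c (y - x) (f y).

Lemma analytic_at_CV_radius (c : nat -> R) (f : R -> R) (x rho y : R) :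
  (forall y, Rabs (y - x) < rho -> is_pseries c (y - x) (f y)) ->
  Rabs (y - x) < rho -> Rbar_lt (Rabs (y - x)) (CV_radius c).
Proof.
  intros H Hy. apply CV_radius_gt_of_ex_pseries with rho; [|easy].
  intros t Ht. exists (f (x + t)).
  specialize (H (x + t)). replace (x + t - x) with t in H by ring. exact (H Ht).
Qed.

Lemma analytic_at_ext_loc (f g : R -> R) (x : R) :
  locally x (fun y => f y = g y) -> analytic_at f x -> analytic_at g x.
Proof.
  intros [d Hd] (c & rho & Hrho & H).
  exists c, (Rmin rho d). split; [apply Rmin_glb_lt; [easy|apply cond_pos]|].
  intros y Hy. rewrite <- Hd.
  - apply H. apply Rlt_le_trans with (1 := Hy), Rmin_l.
  - apply Rlt_le_trans with (1 := Hy), Rmin_r.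
Qed.

Definition PS_const (k : R) (n : nat) : R := match n with 0%nat => k | _ => 0 end.

Lemma is_pseries_const (k t : R) : is_pseries (PS_const k) t k.
Proof.
  apply is_pseries_R. unfold is_series.
  apply (filterlim_ext (fun _ => k)); [|apply filterlim_const].
  intros n. induction n as [|n IH].
  - rewrite sum_O. cbn. ring.
  - rewrite sum_Sn, <- IH. unfold plus; cbn. ring.
Qed.

Lemma analytic_at_const (k x : R) : analytic_at (fun _ => k) x.
Proof. exists (PS_const k), 1. split; [lra|]. intros y _. apply is_pseries_const. Qed.

Lemma analytic_at_plus (f g : R -> R) (x : R) :
  analytic_at f x -> analytic_at g x -> analytic_at (fun y => f y + g y) x.
Proof.
  intros (c & rho & Hrho & H) (c' & rho' & Hrho' & H').
  exists (PS_plus c c'), (Rmin rho rho'). split; [now apply Rmin_glb_lt|].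
  intros y Hy. apply (is_pseries_plus (K := R_AbsRing) (V := R_NormedModule)).
  - apply H. apply Rlt_le_trans with (1 := Hy), Rmin_l.
  - apply H'. apply Rlt_le_trans with (1 := Hy), Rmin_r.
Qed.

Lemma analytic_at_mult (f g : R -> R) (x : R) :
  analytic_at f x -> analytic_at g x -> analytic_at (fun y => f y * g y) x.
Proof.
  intros (c & rho & Hrho & H) (c' & rho' & Hrho' & H').
  exists (PS_mult c c'), (Rmin rho rho'). split; [now apply Rmin_glb_lt|].
  intros y Hy.
  assert (Hy1 : Rabs (y - x) < rho) by apply Rlt_le_trans with (1 := Hy), Rmin_l.
  assert (Hy2 : Rabs (y - x) < rho') by apply Rlt_le_trans with (1 := Hy), Rmin_r.
  apply is_pseries_mult; auto; eapply analytic_at_CV_radius; eassumption.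
Qed.

Lemma analytic_at_exp_scal (k x : R) : analytic_at (fun y => exp (k * y)) x.
Proof.
  exists (fun n => exp (k * x) * (/ INR (Factorial.fact n) * k ^ n)), 1. split; [lra|].
  intros y _. apply is_pseries_R.
  replace (exp (k * y)) with (exp (k * x) * exp (k * (y - x)))
    by (rewrite <- exp_plus; f_equal; ring).
  pose proof (proj1 (is_pseries_R _ _ _) (is_exp_Reals (k * (y - x)))) as E.
  apply (is_series_scal (exp (k * x))) in E. revert E. apply is_series_ext.
  intros n. unfold scal; cbn; unfold mult; cbn. rewrite Rpow_mult_distr. ring.
Qed.

Lemma analytic_at_sinh_scal (k x : R) : analytic_at (fun y => sinh (k * y)) x.
Proof.
  apply (analytic_at_ext_loc (fun y => / 2 * exp (k * y) + - / 2 * exp (- k * y))).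
  - apply filter_forall. intros y. unfold sinh.
    replace (- (k * y)) with (- k * y) by ring. field.
  - apply analytic_at_plus; apply analytic_at_mult;
      apply analytic_at_const || apply analytic_at_exp_scal.
Qed.

Lemma analytic_at_cosh_scal (k x : R) : analytic_at (fun y => cosh (k * y)) x.
Proof.
  apply (analytic_at_ext_loc (fun y => / 2 * exp (k * y) + / 2 * exp (- k * y))).
  - apply filter_forall. intros y. unfold cosh.
    replace (- (k * y)) with (- k * y) by ring. field.
  - apply analytic_at_plus; apply analytic_at_mult;
      apply analytic_at_const || apply analytic_at_exp_scal.
Qed.

(* [inv_coeffs c n] agrees with the coefficients of the formal inverse of [c] up to index [n]. *)
Fixpoint inv_coeffs (c : nat -> R) (n : nat) : nat -> R :=
  match n with
  | 0%nat => fun _ => / c 0%nat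
  | S m => fun i =>
      if (i <=? m)%nat then inv_coeffs c m i
      else - / c 0%nat * sum_f_R0 (fun k => inv_coeffs c m k * c (S m - k)%nat) m
  end.

Definition PS_inv (c : nat -> R) (n : nat) : R := inv_coeffs c n n.

Lemma inv_coeffs_stable (c : nat -> R) (n i : nat) : (i <= n)%nat -> inv_coeffs c n i = PS_inv c i.
Proof.
  induction n as [|n IH]; intros Hi.
  - now replace i with 0%nat by lia.
  - destruct (Nat.eq_dec i (S n)) as [->|Hn]; [easy|].
    cbn. destruct (Nat.leb_spec i n); [now apply IH|lia].
Qed.

Lemma PS_inv_S (c : nat -> R) (n : nat) :
  PS_inv c (S n) = - / c 0%nat * sum_f_R0 (fun k => PS_inv c k * c (S n - k)%nat) n.
Proof.
  unfold PS_inv at 1. cbn [inv_coeffs]. destruct (Nat.leb_spec (S n) n); [lia|].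
  f_equal. apply sum_eq. intros k Hk. now rewrite inv_coeffs_stable.
Qed.

Lemma PS_mult_inv (c : nat -> R) (n : nat) :
  c 0%nat <> 0 -> PS_mult (PS_inv c) c n = PS_const 1 n.
Proof.
  intros H. unfold PS_mult. destruct n as [|n].
  - cbn. now apply Rinv_l.
  - rewrite tech5, PS_inv_S, Nat.sub_diag. cbn [PS_const]. field. easy.
Qed.

(** The geometric sum in division-free form; it evaluates the majorant of the convolution in
    [PS_inv_S]. *)
Lemma sum_geometric_convolution (p q : R) (n : nat) :
  (p - q) * sum_f_R0 (fun k => p ^ k * q ^ (S n - k)) n = q * (p ^ S n - q ^ S n).
Proof.
  induction n as [|n IH].
  - cbn. ring.
  - rewrite tech5.
    replace (sum_f_R0 _ n) with (q * sum_f_R0 (fun k => p ^ k * q ^ (S n - k)) n).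
    + rewrite Nat.sub_succ_l, Nat.sub_diag by lia.
      transitivity (q * ((p - q) * sum_f_R0 (fun k => p ^ k * q ^ (S n - k)) n)
        + (p - q) * (p ^ S n * q)); [cbn; ring|].
      rewrite IH. cbn. ring.
    + rewrite scal_sum. apply sum_eq. intros k Hk.
      rewrite (Nat.sub_succ_l k (S n)) by lia. cbn [pow]. ring.
Qed.

(** The ratio [p] is chosen so that [p - q = q M i0], with [i0] the modulus of [1 / c 0]. The
    majorant of the recursion then collapses to [i0 (p^(n+1) - q^(n+1))], which closes the
    induction. *)
Lemma PS_inv_bound (c : nat -> R) (M q : R) :
  c 0%nat <> 0 -> 0 < M -> 0 < q -> (forall n, Rabs (c n) <= M * q ^ n) ->
  let p := q * (1 + M * Rabs (/ c 0%nat)) in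
  forall n, Rabs (PS_inv c n) <= Rabs (/ c 0%nat) * p ^ n.
Proof.
  intros H0 HM Hq Hc p n.
  set (i0 := Rabs (/ c 0%nat)) in *.
  assert (Hi0 : 0 < i0) by (apply Rabs_pos_lt, Rinv_neq_0_compat, H0).
  assert (HMi : 0 < M * i0) by (apply Rmult_lt_0_compat; easy).
  assert (Hp : 0 < p) by (apply Rmult_lt_0_compat; lra).
  induction n as [n IH] using (well_founded_induction Nat.lt_wf_0). destruct n as [|n].
  - unfold PS_inv, i0; cbn. lra.
  - rewrite PS_inv_S, Rabs_mult, Rabs_Ropp. fold i0.
    apply Rmult_le_compat_l; [lra|].
    apply Rle_trans with (1 := Rabs_triang_gen _ _).
    apply Rle_trans with (sum_f_R0 (fun k => (p ^ k * q ^ (S n - k)) * (i0 * M)) n).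
    + apply sum_Rle. intros k Hk. rewrite Rabs_mult.
      replace (p ^ k * q ^ (S n - k) * (i0 * M)) with ((i0 * p ^ k) * (M * q ^ (S n - k))) by ring.
      apply Rmult_le_compat; try apply Rabs_pos; [apply IH; lia|apply Hc].
    + rewrite <- scal_sum.
      pose proof (sum_geometric_convolution p q n) as E.
      set (T := sum_f_R0 (fun k => p ^ k * q ^ (S n - k)) n) in *.
      replace (p - q) with (q * (i0 * M)) in E by (unfold p; ring).
      assert (E' : i0 * M * T = p ^ S n - q ^ S n).
      { apply Rmult_eq_reg_l with q; [|lra]. rewrite <- E. ring. }
      rewrite E'. pose proof (pow_lt q (S n) Hq). lra.
Qed.

Lemma analytic_at_inv (f : R -> R) (x : R) :
  f x <> 0 -> analytic_at f x -> analytic_at (fun y => / f y) x.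
Proof.
  intros Hx (c & rho & Hrho & H).
  assert (H0 : c 0%nat = f x).
  { assert (E := H x). rewrite Rminus_eq_0, Rabs_R0 in E. specialize (E Hrho).
    apply is_pseries_unique in E. now rewrite PSeries_0 in E. }
  rewrite <- H0 in Hx.
  (* Convergence at the interior point [rho / 2] gives [c] geometric growth with ratio
     [q = 2 / rho], the input of [PS_inv_bound]. *)
  destruct (pseries_terms_bounded c (rho / 2)) as (M & HM & Bc).
  { assert (E := H (x + rho / 2)). replace (x + rho / 2 - x) with (rho / 2) in E by ring.
    exists (f (x + rho / 2)). apply E. rewrite Rabs_pos_eq; lra. }
  assert (Hq : 0 < / (rho / 2)) by (apply Rinv_0_lt_compat; lra).
  assert (Bc' : forall n, Rabs (c n) <= M * (/ (rho / 2)) ^ n).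
  { intros n. specialize (Bc n). pose proof (pow_lt (rho / 2) n ltac:(lra)) as P.
    rewrite pow_inv. rewrite Rabs_mult, (Rabs_pos_eq (_ ^ n)) in Bc by lra.
    apply Rmult_le_reg_r with ((rho / 2) ^ n); [easy|].
    rewrite Rmult_assoc, Rinv_l by lra. lra. }
  pose proof (PS_inv_bound c M _ Hx HM Hq Bc') as B. cbv zeta in B.
  set (p := / (rho / 2) * (1 + M * Rabs (/ c 0%nat))) in B.
  assert (Hp : 0 < p).
  { pose proof (Rabs_pos (/ c 0%nat)). apply Rmult_lt_0_compat; [easy|]. nra. }
  assert (CV : Rbar_le (/ p) (CV_radius (PS_inv c))).
  { apply (proj1 (CV_radius_bounded _)). exists (Rabs (/ c 0%nat)). intros n.
    rewrite Rabs_mult, (Rabs_pos_eq (_ ^ n)) by (apply pow_le; left; now apply Rinv_0_lt_compat).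
    rewrite pow_inv. pose proof (pow_lt p n Hp).
    apply Rmult_le_reg_r with (p ^ n); [easy|].
    rewrite Rmult_assoc, Rinv_l by lra. rewrite Rmult_1_r. apply B. }
  exists (PS_inv c), (Rmin rho (/ p)).
  split; [apply Rmin_glb_lt; [easy|now apply Rinv_0_lt_compat]|].
  intros y Hy.
  assert (Hy1 : Rabs (y - x) < rho) by apply Rlt_le_trans with (1 := Hy), Rmin_l.
  assert (Hy2 : Rbar_lt (Rabs (y - x)) (CV_radius (PS_inv c))).
  { apply Rbar_lt_le_trans with (2 := CV). apply Rlt_le_trans with (1 := Hy), Rmin_r. }
  (* The Cauchy product of the two series is the constant series [1]. This also shows that [f y] is
     nonzero near [x]. *)
  assert (E : PSeries (PS_inv c) (y - x) * f y = 1).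
  { rewrite <- (is_pseries_unique _ _ _ (H y Hy1)).
    rewrite <- PSeries_mult; [|easy|].
    - rewrite (PSeries_ext _ (PS_const 1)) by (intros n; now apply PS_mult_inv).
      apply is_pseries_unique, is_pseries_const.
    - eapply analytic_at_CV_radius; eassumption. }
  replace (/ f y) with (PSeries (PS_inv c) (y - x)).
  - now apply PSeries_correct, CV_radius_inside.
  - apply Rmult_eq_reg_r with (f y); [rewrite E, Rinv_l|]; try easy;
      intros Z; rewrite Z in E; lra.
Qed.

(** The termwise integral of the series of [f] differs from [F] by a function with zero derivative,
    hence by the constant [F x]. *)
Lemma analytic_at_antiderivative (F f : R -> R) (x : R) :
  locally x (fun y => is_derive F y (f y)) -> analytic_at f x -> analytic_at F x.
Proof.
  intros [d Hd] (c & rho & Hrho & H).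
  set (rh := Rmin rho d).
  assert (Hrh : 0 < rh) by (apply Rmin_glb_lt; [easy|apply cond_pos]).
  assert (CV : forall y, Rabs (y - x) < rho -> Rbar_lt (Rabs (y - x)) (CV_radius c)).
  { intros y Hy. eapply analytic_at_CV_radius; eassumption. }
  apply (analytic_at_ext_loc (fun y => F x + PSeries (PS_Int c) (y - x))).
  - exists (mkposreal rh Hrh). intros y Hy.
    assert (E : F y - PSeries (PS_Int c) (y - x) = F x - PSeries (PS_Int c) (x - x)).
    { apply (constant_of_is_derive_0 (fun y => F y - PSeries (PS_Int c) (y - x))).
      intros t Ht.
      assert (Ht' : Rabs (t - x) < rh).
      { apply Rle_lt_trans with (2 := Hy). unfold abs, minus, plus, opp; cbn.
        revert Ht. unfold Rmin, Rmax, Rabs.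
        destruct Rle_dec, Rcase_abs, Rcase_abs; lra. }
      assert (Ht1 : Rabs (t - x) < rho) by apply Rlt_le_trans with (1 := Ht'), Rmin_l.
      assert (Ht2 : Rabs (t - x) < d) by apply Rlt_le_trans with (1 := Ht'), Rmin_r.
      replace 0 with (f t - 1 * f t) by ring.
      apply (is_derive_minus F).
      - apply Hd, Ht2.
      - apply (is_derive_comp (PSeries (PS_Int c)) (fun y => y - x)).
        + rewrite <- (is_pseries_unique _ _ _ (H t Ht1)).
          rewrite (PSeries_ext c (PS_derive (PS_Int c))).
          * apply is_derive_PSeries. rewrite CV_radius_Int. now apply CV.
          * intros n. unfold PS_derive, PS_Int. field. apply not_0_INR. lia.
        + auto_derive; [easy|ring]. }
    rewrite Rminus_eq_0, PSeries_0 in E. cbn in E. lra.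
  - apply analytic_at_plus; [apply analytic_at_const|].
    exists (PS_Int c), rho. split; [easy|]. intros y Hy.
    apply PSeries_correct, CV_radius_inside. rewrite CV_radius_Int. now apply CV.
Qed.

Lemma analytic_at_ex_derive_n (f : R -> R) (x : R) (n : nat) :
  analytic_at f x -> ex_derive_n f n x.
Proof.
  intros (c & rho & Hrho & H).
  apply (ex_derive_n_ext_loc (fun y => PSeries c (y + - x))).
  - exists (mkposreal rho Hrho). intros y Hy. now apply is_pseries_unique, H.
  - apply ex_derive_n_comp_trans, ex_derive_n_PSeries.
    apply (analytic_at_CV_radius c f x rho x); [easy|]. now rewrite Rminus_eq_0, Rabs_R0.
Qed.

Ltac analytic_at_arith :=
  lazymatch goal with
  | |- analytic_at (fun _ => ?k) ?x => exact (analytic_at_const k x)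
  | |- analytic_at (fun r => @?f r + @?g r) ?x => apply (analytic_at_plus f g x); analytic_at_arith
  | |- analytic_at (fun r => @?f r * @?g r) ?x => apply (analytic_at_mult f g x); analytic_at_arith
  | |- analytic_at (fun r => sinh (?k * r)) ?x => exact (analytic_at_sinh_scal k x)
  | |- analytic_at (fun r => cosh (?k * r)) ?x => exact (analytic_at_cosh_scal k x)
  | |- _ => idtac
  end.

(** * The velocity profile *)

(** [auto_derive] leaves derivatives in this eta-expanded form, and [rewrite] has to match it. *)
Lemma is_derive_unique_eta (f : R -> R) (x l : R) :
  is_derive f x l -> Derive (fun t : R => f t) x = l.
Proof. apply is_derive_unique. Qed.

Lemma is_derive_RInt_pos (f : R -> R) (d x : R) :
  0 < d -> (forall t, 0 < t -> continuous f t) -> 0 < x ->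
  is_derive (fun r => RInt f d r) x (f x).
Proof.
  intros Hd Hf Hx. apply (is_derive_RInt f _ d); [|now apply Hf].
  generalize (locally_gt 0 x Hx). apply filter_imp. intros y Hy.
  apply (RInt_correct f), ex_RInt_continuous. intros z Hz. apply Hf.
  apply Rlt_le_trans with (2 := proj1 Hz). now apply Rmin_glb_lt.
Qed.

(** * One-sided derivatives and behaviour at the left end point *)

Lemma is_derive_within_iff (D : R -> Prop) (f : R -> R) (x l : R) :
  is_derive_within D f x l <->
  forall eps, 0 < eps -> exists d : posreal, forall y,
    D y -> y <> x -> Rabs (y - x) < d -> Rabs ((f y - f x) / (y - x) - l) < eps.
Proof.
  split.
  - intros H eps Heps.
    assert (L : locally l (fun z => Rabs (z - l) < eps)).
    { exists (mkposreal eps Heps). intros z Hz. exact Hz. }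
    destruct (H _ L) as [d Hd]. exists d. intros y HD Hy Hyx. exact (Hd y Hyx Hy HD).
  - intros H P [eps HP]. destruct (H eps (cond_pos eps)) as [d Hd].
    exists d. intros y Hyx Hy HD. apply HP, Hd; assumption.
Qed.

Lemma is_derive_within_of_is_derive (D : R -> Prop) (f : R -> R) (x l : R) :
  is_derive f x l -> is_derive_within D f x l.
Proof.
  intros H. apply is_derive_Reals in H. apply is_derive_within_iff.
  intros eps Heps. destruct (H eps Heps) as [d Hd]. exists d. intros y _ Hy Hyx.
  specialize (Hd (y - x)). replace (x + (y - x)) with y in Hd by ring. apply Hd; [lra|easy].
Qed.

Lemma is_derive_of_within_interior (lo : R) (f : R -> R) (x l : R) :
  lo < x -> is_derive_within (fun y => lo <= y) f x l -> is_derive f x l.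
Proof.
  intros Hx H. apply is_derive_Reals. intros eps Heps.
  destruct (proj1 (is_derive_within_iff _ _ _ _) H eps Heps) as [d Hd].
  assert (Hd' : 0 < Rmin d (x - lo)) by (apply Rmin_glb_lt; [apply cond_pos|lra]).
  exists (mkposreal _ Hd'). cbn. intros h Hh Hhd. specialize (Hd (x + h)).
  replace (x + h - x) with h in Hd by ring.
  pose proof (Rmin_l d (x - lo)). pose proof (Rmin_r d (x - lo)).
  apply Hd; try lra. apply Rabs_def2 in Hhd. lra.
Qed.

(** Extending [f] by a constant to the left of [lo] turns one-sided continuity into [continuity_pt].
    Near [lo] the difference quotients are below [K], whence a Lipschitz bound. *)
Lemma continuity_pt_Rmax_of_within (lo : R) (f : R -> R) (l : R) :
  is_derive_within (fun y => lo <= y) f lo l ->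
  continuity_pt (fun x => f (Rmax lo x)) lo.
Proof.
  intros H. apply continuity_pt_locally. intros eps.
  destruct (proj1 (is_derive_within_iff _ _ _ _) H 1 Rlt_0_1) as [d Hd].
  set (K := Rabs l + 1). assert (HK : 0 < K) by (pose proof (Rabs_pos l); unfold K; lra).
  assert (Hd' : 0 < Rmin d (eps / K)).
  { apply Rmin_glb_lt; [apply cond_pos|apply Rdiv_lt_0_compat; [apply cond_pos|easy]]. }
  exists (mkposreal _ Hd'). intros x Hx.
  change (Rabs (x - lo) < Rmin d (eps / K)) in Hx.
  pose proof (Rmin_l d (eps / K)). pose proof (Rmin_r d (eps / K)).
  rewrite (Rmax_left lo lo) by lra.
  destruct (Rle_lt_dec x lo) as [L|L].
  - rewrite Rmax_left, Rminus_eq_0, Rabs_R0 by easy. apply cond_pos.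
  - rewrite Rmax_right by lra. specialize (Hd x).
    assert (Q : Rabs ((f x - f lo) / (x - lo) - l) < 1) by (apply Hd; lra).
    assert (Q' : Rabs ((f x - f lo) / (x - lo)) < K).
    { pose proof (Rabs_triang ((f x - f lo) / (x - lo) - l) l) as T.
      replace ((f x - f lo) / (x - lo) - l + l) with ((f x - f lo) / (x - lo)) in T by ring.
      unfold K; lra. }
    replace (f x - f lo) with ((f x - f lo) / (x - lo) * (x - lo)) by (field; lra).
    rewrite Rabs_mult.
    apply Rlt_le_trans with (K * Rabs (x - lo)).
    + apply Rmult_lt_compat_r; [apply Rabs_pos_lt; lra|easy].
    + replace (pos eps) with (K * (eps / K)) by (field; lra).
      apply Rmult_le_compat_l; lra.
Qed.

Lemma eq_of_right_constant (F : R -> R) (x c : R) :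
  continuity_pt F x -> (forall y, x < y -> F y = c) -> F x = c.
Proof.
  intros HF Hc. destruct (Req_dec (F x) c) as [E|E]; [easy|exfalso].
  assert (He : 0 < Rabs (c - F x)) by (apply Rabs_pos_lt; lra).
  destruct (proj1 (continuity_pt_locally F x) HF (mkposreal _ He)) as [d Hd].
  pose proof (cond_pos d) as Hd0.
  specialize (Hd (x + d / 2)). cbn in Hd. rewrite (Hc (x + d / 2)) in Hd by lra.
  apply (Rlt_irrefl (Rabs (c - F x))), Hd.
  change (Rabs (x + d / 2 - x) < d). replace (x + d / 2 - x) with (d / 2) by ring.
  rewrite Rabs_pos_eq; lra.
Qed.

(** Constancy is assumed strictly to the right of [x], so [F x] itself cannot be compared. Equal
    values at [x + h] and [x + h / 2] make one difference quotient twice the other, yet both lie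
    within a quarter of [l] from [l]. *)
Lemma not_right_constant_of_derive_neg (F : R -> R) (x e l : R) :
  0 < e -> is_derive F x l -> l < 0 ->
  ~ (forall y z, x < y < x + e -> x < z < x + e -> F y = F z).
Proof.
  intros He HF Hl Hc. apply is_derive_Reals in HF.
  destruct (HF (- l / 4)) as [d Hd]; [lra|].
  pose proof (cond_pos d) as Hd0.
  set (h := Rmin e d / 2).
  assert (Hh : 0 < h < e /\ h < d).
  { unfold h. pose proof (Rmin_l e d). pose proof (Rmin_r e d).
    assert (0 < Rmin e d) by now apply Rmin_glb_lt. lra. }
  pose proof (Hd h) as B1. pose proof (Hd (h / 2)) as B2.
  rewrite Rabs_pos_eq in B1, B2 by lra.
  specialize (B1 ltac:(lra) ltac:(lra)). specialize (B2 ltac:(lra) ltac:(lra)).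
  rewrite (Hc (x + h / 2) (x + h)) in B2 by lra.
  replace ((F (x + h) - F x) / (h / 2)) with (2 * ((F (x + h) - F x) / h)) in B2 by (field; lra).
  apply Rabs_def2 in B1. apply Rabs_def2 in B2. lra.
Qed.

(* Gronwall for the energy [(W^2 + W'^2) exp (- (1 + Q) x)]. *)
Lemma linear_ode_unique (lo Q : R) (W W1 W2 p q : R -> R) :
  continuity_pt W lo -> continuity_pt W1 lo -> W lo = 0 -> W1 lo = 0 ->
  (forall x, lo < x -> is_derive W x (W1 x)) ->
  (forall x, lo < x -> is_derive W1 x (W2 x)) ->
  (forall x, lo < x -> 0 <= p x) ->
  (forall x, lo < x -> 0 <= q x <= Q) ->
  (forall x, lo < x -> W2 x = - p x * W1 x + q x * W x) ->
  forall x, lo < x -> W x = 0.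
Proof.
  intros C0 C1 I0 I1 D0 D1 Hp Hq HW x Hx.
  set (E := fun y => (W y * W y + W1 y * W1 y) * exp (- (1 + Q) * y)).
  set (E' := fun y => (2 * W y * W1 y + 2 * W1 y * W2 y
    - (1 + Q) * (W y * W y + W1 y * W1 y)) * exp (- (1 + Q) * y)).
  assert (DE : forall y, lo < y -> is_derive E y (E' y)).
  { intros y Hy. specialize (D0 y Hy). specialize (D1 y Hy).
    unfold E, E'. auto_derive.
    - repeat split; eexists; eassumption.
    - rewrite (is_derive_unique_eta W _ _ D0), (is_derive_unique_eta W1 _ _ D1). ring. }
  destruct (MVT_gen E lo x E') as (z & Hz & M).
  - intros y Hy. rewrite Rmin_left in Hy by lra. now apply DE.
  - intros y Hy. rewrite Rmin_left in Hy by lra. destruct (Req_dec y lo) as [->|N].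
    + unfold E. repeat apply continuity_pt_mult || apply continuity_pt_plus; try easy.
      apply continuity_pt_filterlim, (ex_derive_continuous (fun y => exp (- (1 + Q) * y))).
      auto_derive; easy.
    + apply continuity_pt_filterlim, (ex_derive_continuous E). exists (E' y). apply DE; lra.
  - rewrite Rmin_left, Rmax_right in Hz by lra.
    assert (N : E' z <= 0).
    (* The mean value point may be [lo], where the equation is not assumed; there [W] and [W1]
       vanish, hence so does [E']. *)
    { unfold E'. destruct (Req_dec z lo) as [->|Nz].
      - rewrite I0, I1. lra.
      - assert (Hz' : lo < z) by lra. specialize (Hp z Hz'). specialize (Hq z Hz').
        rewrite (HW z Hz').
        (* From [2 W W1 <= W^2 + W1^2] weighted by [1 + q], from [q <= Q], and from the sign of the
           damping term [- 2 p W1^2]. *)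
        assert (2 * W z * W1 z + 2 * W1 z * (- p z * W1 z + q z * W z)
          - (1 + Q) * (W z * W z + W1 z * W1 z) <= 0).
        { assert (0 <= (1 + q z) * ((W z - W1 z) * (W z - W1 z)))
            by (apply Rmult_le_pos; [lra|apply Rle_0_sqr]).
          assert (0 <= (Q - q z) * (W z * W z + W1 z * W1 z))
            by (apply Rmult_le_pos; [lra|apply Rplus_le_le_0_compat; apply Rle_0_sqr]).
          assert (0 <= p z * (W1 z * W1 z)) by (apply Rmult_le_pos; [lra|apply Rle_0_sqr]). lra. }
        pose proof (exp_pos (- (1 + Q) * z)). nra. }
    assert (E lo = 0) by (unfold E; rewrite I0, I1; ring).
    assert (P : E x <= 0) by nra.
    unfold E in P. pose proof (exp_pos (- (1 + Q) * x)).
    assert (W x * W x + W1 x * W1 x <= 0) by nra. nra.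
Qed.

(** * The explicit solution, its analyticity and its uniqueness *)

Section Profile.

Variables (a : R) (a_pos : 0 < a) (delta : R) (delta_pos : 0 < delta) (alpha1 alpha2 : R).

Lemma sinh_scal_pos (r : R) : 0 < r -> 0 < sinh (a * r).
Proof. intros Hr. apply sinh_pos. nra. Qed.

(** The value of [azimuthal_force] at [delta] dictated by [Y = 0], [Y' = alpha1],
    [Y'' = - alpha2]. *)
Definition profile_force : R := cosh (a * delta) * alpha1 - sinh (a * delta) / a * alpha2.

(** On [(0, oo)] this is [ln ((x + 1) / (x - 1))] with [x = cosh (a r)], minus its value at [delta].
    As an integral it vanishes at [delta] and is analytic by [analytic_at_antiderivative]. *)
Definition log_term (r : R) : R := -2 * a * RInt (fun t => / sinh (a * t)) delta r.

(** Integration constants solved from [f delta = 0] and [f' delta = alpha1 sinh (a delta) / a]; the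
    condition on [Y''] enters through [profile_force]. *)
Let A := alpha2 * sinh (a * delta) / (2 * a ^ 3).
Let B := (alpha1 - alpha2 * sinh (a * delta) * cosh (a * delta) / a) / (4 * a ^ 2).

(* [f = Y sinh (a r) / a] solves [f'' - a coth (a r) f' - 2 a^2 f = profile_force]; in the variable
   [x = cosh (a r)] the homogeneous equation is [(x^2 - 1) f_xx = 2 f], with solutions
   [x^2 - 1] and [2 x - (x^2 - 1) ln ((x + 1) / (x - 1))]. *)
Definition stream_derivative (r : R) : R :=
  A * sinh (a * r) ^ 2 + B * (2 * cosh (a * r) - sinh (a * r) ^ 2 * log_term r)
  - profile_force / (2 * a ^ 2).
Let f := stream_derivative.
Let f1 (r : R) : R :=
  2 * a * A * sinh (a * r) * cosh (a * r)
  + B * (4 * a * sinh (a * r) - 2 * a * sinh (a * r) * cosh (a * r) * log_term r).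
Let f2 (r : R) : R :=
  2 * a ^ 2 * A * (cosh (a * r) ^ 2 + sinh (a * r) ^ 2)
  + B * (8 * a ^ 2 * cosh (a * r)
         - 2 * a ^ 2 * (cosh (a * r) ^ 2 + sinh (a * r) ^ 2) * log_term r).

Definition profile (r : R) : R := a * f r / sinh (a * r).
Definition profile1 (r : R) : R :=
  a * f1 r / sinh (a * r) - a ^ 2 * f r * cosh (a * r) / sinh (a * r) ^ 2.
Definition profile2 (r : R) : R :=
  a * f2 r / sinh (a * r) - 2 * a ^ 2 * f1 r * cosh (a * r) / sinh (a * r) ^ 2
  - a ^ 3 * f r / sinh (a * r) + 2 * a ^ 3 * f r * cosh (a * r) ^ 2 / sinh (a * r) ^ 3.

Lemma is_derive_log_term (r : R) : 0 < r -> is_derive log_term r (-2 * a / sinh (a * r)).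
Proof.
  intros Hr. apply (is_derive_scal (fun r => RInt (fun t => / sinh (a * t)) delta r)).
  apply (is_derive_RInt_pos (fun t => / sinh (a * t))); [easy| |easy].
  intros t Ht. apply (ex_derive_continuous (fun t => / sinh (a * t))).
  auto_derive. pose proof (sinh_scal_pos t Ht). lra.
Qed.

Lemma is_derive_stream (r : R) : 0 < r -> is_derive f r (f1 r) /\ is_derive f1 r (f2 r).
Proof.
  intros Hr. pose proof (is_derive_log_term r Hr) as DL.
  pose proof (sinh_scal_pos r Hr).
  assert (exL : ex_derive (fun r => log_term r) r) by (eexists; apply DL).
  split; [unfold f, f1, stream_derivative|unfold f1, f2]; (auto_derive; [easy|]);
    rewrite (is_derive_unique_eta log_term _ _ DL); field; lra.
Qed.

Lemma is_derive_profile (r : R) : 0 < r -> is_derive profile r (profile1 r).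
Proof.
  intros Hr. destruct (is_derive_stream r Hr) as [D1 _]. pose proof (sinh_scal_pos r Hr).
  unfold profile, profile1. auto_derive.
  - repeat split; [eexists; apply D1|lra].
  - rewrite (is_derive_unique_eta f _ _ D1). field. lra.
Qed.

Lemma is_derive_profile1 (r : R) : 0 < r -> is_derive profile1 r (profile2 r).
Proof.
  intros Hr. destruct (is_derive_stream r Hr) as [D1 D2]. pose proof (sinh_scal_pos r Hr).
  unfold profile1, profile2. auto_derive.
  - assert (ex_derive (fun r => f r) r) by now exists (f1 r).
    assert (ex_derive (fun r => f1 r) r) by now exists (f2 r).
    assert (sinh (a * r) * (sinh (a * r) * 1) <> 0) by (apply Rgt_not_eq; nra).
    repeat split; lra || assumption.
  - rewrite (is_derive_unique_eta f _ _ D1), (is_derive_unique_eta f1 _ _ D2).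
    field. lra.
Qed.

Lemma azimuthal_force_profile (r : R) :
  0 < r -> azimuthal_force a profile profile1 profile2 r = profile_force.
Proof.
  intros Hr. pose proof (sinh_scal_pos r Hr) as S0.
  pose proof (cosh_sinh_sq (a * r)) as E.
  (* The coefficient of [f] is [- 2 a^2], left in a form that [field] can verify without
     [cosh^2 = 1 + sinh^2]. *)
  transitivity (f2 r - a * cosh (a * r) / sinh (a * r) * f1 r
    + f r * (a ^ 2 * ((cosh (a * r) * cosh (a * r) - 1) / sinh (a * r) ^ 2 - 3))).
  - unfold azimuthal_force, profile, profile1, profile2. field. lra.
  - unfold f, f1, f2, stream_derivative.
    set (S := sinh (a * r)) in *. set (X := cosh (a * r)) in *. set (L := log_term r).
    replace (X * X - 1) with (S ^ 2) by lra.
    replace (X ^ 2) with (X * X) by ring. rewrite E.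
    transitivity (profile_force + 2 * a ^ 2 * (A - B * L) * (1 + S * S - X * X)).
    + field. lra.
    + rewrite E. ring.
Qed.

Lemma log_term_delta : log_term delta = 0.
Proof. unfold log_term. rewrite RInt_point. apply Rmult_0_r. Qed.

Lemma profile_delta : profile delta = 0.
Proof.
  pose proof (sinh_scal_pos delta delta_pos). pose proof (cosh_sinh_sq (a * delta)) as E.
  unfold profile, f, stream_derivative, A, B, profile_force. rewrite log_term_delta.
  transitivity (alpha2 / (2 * a ^ 2) * (1 + sinh (a * delta) * sinh (a * delta)
    - cosh (a * delta) * cosh (a * delta))).
  - field. lra.
  - rewrite E. ring.
Qed.

Lemma profile1_delta : profile1 delta = alpha1.
Proof.
  pose proof (sinh_scal_pos delta delta_pos) as S0.
  assert (F0 : f delta = 0).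
  { apply Rmult_eq_reg_l with (a / sinh (a * delta)).
    - rewrite Rmult_0_r, <- profile_delta. unfold profile. field. lra.
    - apply Rgt_not_eq, Rdiv_lt_0_compat; easy. }
  unfold profile1. rewrite F0. unfold f1, A, B. rewrite log_term_delta. field. lra.
Qed.

(** Read off from the force equation at [delta], where [Y] and [Y'] are already known. *)
Lemma profile2_delta : profile2 delta = - alpha2.
Proof.
  pose proof (sinh_scal_pos delta delta_pos) as S0.
  pose proof (azimuthal_force_profile delta delta_pos) as E.
  unfold azimuthal_force, profile_force in E. rewrite profile_delta, profile1_delta in E.
  assert (0 < sinh (a * delta) / a) by (apply Rdiv_lt_0_compat; easy).
  apply Rmult_eq_reg_l with (sinh (a * delta) / a); lra.
Qed.

Lemma analytic_at_inv_sinh (x : R) : 0 < x -> analytic_at (fun r => / sinh (a * r)) x.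
Proof.
  intros Hx. apply (analytic_at_inv (fun r => sinh (a * r))); [|apply analytic_at_sinh_scal].
  now apply Rgt_not_eq, sinh_scal_pos.
Qed.

Lemma analytic_at_log_term (x : R) : 0 < x -> analytic_at log_term x.
Proof.
  intros Hx. apply (analytic_at_antiderivative _ (fun r => -2 * a * / sinh (a * r))).
  - generalize (locally_gt 0 x Hx). apply filter_imp, is_derive_log_term.
  - apply analytic_at_mult; [apply analytic_at_const|now apply analytic_at_inv_sinh].
Qed.

Lemma analytic_at_profile (x : R) : 0 < x -> analytic_at profile x.
Proof.
  intros Hx.
  (* The same function written with sums, products and one reciprocal only, the shapes that
     [analytic_at_arith] recognizes. *)
  apply (analytic_at_ext_loc (fun r => a * (A * (sinh (a * r) * sinh (a * r))
    + B * (2 * cosh (a * r) + -1 * (sinh (a * r) * sinh (a * r) * log_term r))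
    + - (profile_force / (2 * a ^ 2))) * / sinh (a * r))).
  - apply filter_forall. intros r. unfold profile, f, stream_derivative.
    unfold Rdiv. ring.
  - analytic_at_arith.
    + now apply analytic_at_log_term.
    + now apply analytic_at_inv_sinh.
Qed.

Lemma profile_smooth_with_initial_data : smooth_with_initial_data delta alpha1 alpha2 profile.
Proof.
  exists (Derive_n profile). split; [split|].
  - easy.
  - intros n x Hx. apply is_derive_within_of_is_derive, Derive_correct.
    apply (analytic_at_ex_derive_n profile x (S n)), analytic_at_profile. lra.
  - assert (D1 : forall x, 0 < x -> Derive profile x = profile1 x).
    { intros x Hx. now apply is_derive_unique, is_derive_profile. }
    split; [apply profile_delta|]. split.
    + cbn. rewrite D1 by easy. apply profile1_delta.
    + cbn. rewrite (Derive_ext_loc _ profile1).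
      * rewrite <- profile2_delta. now apply is_derive_unique, is_derive_profile1.
      * generalize (locally_gt 0 delta delta_pos). apply filter_imp, D1.
Qed.

Lemma profile_unique (Z : R -> R) (D : nat -> R -> R) :
  smooth_with_derivatives delta Z D -> D 0%nat delta = 0 -> D 1%nat delta = alpha1 ->
  D 2%nat delta = - alpha2 ->
  (forall r r', delta < r -> delta < r' ->
     azimuthal_force a Z (D 1%nat) (D 2%nat) r = azimuthal_force a Z (D 1%nat) (D 2%nat) r') ->
  forall x, delta <= x -> Z x = profile x.
Proof.
  intros [HZ HD] I0 I1 I2 HF.
  (* Constant extension to the left of [delta], so that two-sided continuity at [delta] makes
     sense. *)
  set (E := fun n x => D n (Rmax delta x)).
  assert (EE : forall n x, delta <= x -> E n x = D n x).
  { intros n x Hx. unfold E. now rewrite Rmax_right. }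
  assert (CE : forall n, continuity_pt (E n) delta).
  { intros n. apply (continuity_pt_Rmax_of_within delta (D n) (D (S n) delta)). apply HD. lra. }
  assert (DE : forall n x, delta < x -> is_derive (E n) x (E (S n) x)).
  { intros n x Hx. rewrite EE by lra. apply (is_derive_ext_loc (D n)).
    - generalize (locally_gt delta x Hx). apply filter_imp. intros t Ht. rewrite EE; [easy|lra].
    - apply (is_derive_of_within_interior delta); [easy|]. apply HD. lra. }
  assert (cont : forall h : R -> R, ex_derive h delta -> continuity_pt h delta).
  { intros h Hh. now apply continuity_pt_filterlim, (ex_derive_continuous h). }
  pose proof (sinh_scal_pos delta delta_pos) as S0.
  assert (Force : forall x, delta < x ->
    azimuthal_force a (E 0%nat) (E 1%nat) (E 2%nat) x = profile_force).
  { intros x Hx.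
    replace profile_force with (azimuthal_force a (E 0%nat) (E 1%nat) (E 2%nat) delta).
    (* The force is constant only beyond [delta]; continuity of the extended derivatives carries its
       value to [delta], where the data give [profile_force]. *)
    - symmetry. apply eq_of_right_constant.
      + unfold azimuthal_force.
        apply continuity_pt_minus; [apply continuity_pt_plus|]; apply continuity_pt_mult;
          try apply CE; apply cont; auto_derive; repeat split; lra.
      + intros y Hy. unfold azimuthal_force. rewrite !EE, !HZ by lra.
        now apply HF.
    - unfold azimuthal_force, profile_force. rewrite !EE, I0, I1, I2 by lra. ring. }
  intros x Hx. destruct Hx as [Hx| <-].
  2:{ rewrite <- HZ, I0, profile_delta by lra. easy. }
  rewrite <- HZ, <- EE by lra. apply Rminus_diag_uniq.
  (* The difference to the explicit profile has zero force and zero data. Its zeroth-order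
     coefficient decreases in [r], so the value at [delta] bounds it. *)
  apply (linear_ode_unique delta (2 * a ^ 2 + a ^ 2 / sinh (a * delta) ^ 2)
    (fun x => E 0%nat x - profile x) (fun x => E 1%nat x - profile1 x)
    (fun x => E 2%nat x - profile2 x)
    (fun x => a * cosh (a * x) / sinh (a * x))
    (fun x => 2 * a ^ 2 + a ^ 2 / sinh (a * x) ^ 2)).
  - apply continuity_pt_minus; [apply CE|]. apply cont. eexists. now apply is_derive_profile.
  - apply continuity_pt_minus; [apply CE|]. apply cont. eexists. now apply is_derive_profile1.
  - rewrite EE, I0, profile_delta by lra. ring.
  - rewrite EE, I1, profile1_delta by lra. ring.
  - intros y Hy. apply (is_derive_minus (E 0%nat)); [now apply DE|]. apply is_derive_profile; lra.
  - intros y Hy. apply (is_derive_minus (E 1%nat)); [now apply DE|]. apply is_derive_profile1; lra.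
  - intros y Hy. pose proof (sinh_scal_pos y ltac:(lra)). pose proof (cosh_pos (a * y)).
    left. apply Rdiv_lt_0_compat; [|easy]. now apply Rmult_lt_0_compat.
  - intros y Hy.
    assert (M : sinh (a * delta) < sinh (a * y)) by (apply sinh_lt; nra).
    assert (0 < a ^ 2) by nra. assert (0 < sinh (a * delta) ^ 2) by nra.
    assert (sinh (a * delta) ^ 2 <= sinh (a * y) ^ 2) by nra.
    split.
    + assert (0 < a ^ 2 / sinh (a * y) ^ 2) by (apply Rdiv_lt_0_compat; lra). lra.
    + apply Rplus_le_compat_l, Rmult_le_compat_l; [lra|]. apply Rinv_le_contravar; lra.
  - intros y Hy. pose proof (sinh_scal_pos y ltac:(lra)) as Sy.
    pose proof (Force y Hy) as F1. rewrite <- (azimuthal_force_profile y) in F1 by lra.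
    unfold azimuthal_force in F1.
    apply Rmult_eq_reg_l with (sinh (a * y) / a);
      [|apply Rgt_not_eq, Rdiv_lt_0_compat; easy].
    transitivity (- cosh (a * y) * (E 1%nat y - profile1 y)
      + (2 * a * sinh (a * y) + a / sinh (a * y)) * (E 0%nat y - profile y)); [lra|].
    field. lra.
  - easy.
Qed.

End Profile.

Theorem theorem1p9 (a nu : R) (a_pos : 0 < a) (nu_pos : 0 < nu)
    (O e1 e2 : R3) (HO : H2 a O) (He : oriented_orthonormal_basis O e1 e2)
    (delta tau : R) (delta_pos : 0 < delta) (Htau : 0 < tau < 2 * PI)
    (K : R3 -> Prop) (K_compact : compact_set K)
    (K_sub : forall p, K p -> H2 a p /\ hyp_dist a p O <= delta)
    (K_arc : forall p, arc a O e1 e2 delta tau p -> boundary_in (H2 a) K p) :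
  (forall alpha1 alpha2 : R, 0 < alpha1 -> 0 < alpha2 ->
   forall eps0 : R, 0 < eps0 ->
     ~ satisfies_NS a nu O e1 e2
         (parallel_flow a (fun r => quadratic_profile alpha1 alpha2 (r - delta)))
         (sector a O e1 e2 delta tau eps0))
  /\
  (forall alpha1 alpha2 : R, 0 < alpha1 -> 0 < alpha2 ->
   exists Y : R -> R,
     smooth_with_initial_data delta alpha1 alpha2 Y /\
     satisfies_NS a nu O e1 e2 (parallel_flow a Y)
       (exterior_region a O e1 e2 delta tau) /\
     (forall Z : R -> R,
        smooth_with_initial_data delta alpha1 alpha2 Z ->
        satisfies_NS a nu O e1 e2 (parallel_flow a Z)
          (exterior_region a O e1 e2 delta tau) ->
        forall x, delta <= x -> Z x = Y x) /\
     analytic_from delta Y).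
Proof.
  split; intros alpha1 alpha2 H1 H2.
  - intros eps0 Heps NS.
    set (h := fun r => quadratic_profile alpha1 alpha2 (r - delta)) in NS.
    set (h1 := fun r => alpha1 - alpha2 * (r - delta)).
    set (h2 := fun _ : R => - alpha2).
    pose proof (sinh_scal_pos a a_pos delta delta_pos) as S0.
    pose proof (cosh_pos (a * delta)) as X0.
    (* At [delta] the profile vanishes and its third derivative is zero, so [F'] reduces to [2 cosh
       Y'' + a sinh Y' - (2 a sinh + a / sinh) Y'] there. *)
    apply (not_right_constant_of_derive_neg (azimuthal_force a h h1 h2) delta eps0
      (- 2 * cosh (a * delta) * alpha2 - (a * sinh (a * delta) + a / sinh (a * delta)) * alpha1)).
    + easy.
    + unfold azimuthal_force, h, h1, h2, quadratic_profile. auto_derive; [lra|].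
      field. lra.
    + assert (0 < a / sinh (a * delta)) by (apply Rdiv_lt_0_compat; easy).
      assert (0 < a * sinh (a * delta)) by (apply Rmult_lt_0_compat; easy).
      assert (0 < cosh (a * delta) * alpha2) by (apply Rmult_lt_0_compat; easy).
      assert (0 < (a * sinh (a * delta) + a / sinh (a * delta)) * alpha1)
        by (apply Rmult_lt_0_compat; lra).
      lra.
    + apply (azimuthal_force_constant a nu a_pos nu_pos O e1 e2 HO He h h1 h2
        (sector a O e1 e2 delta tau eps0) delta (delta + eps0) tau); try lra; try easy.
      * intros r th Hr Hth. apply polar_map_sector; easy.
      * intros x _. unfold h, h1, quadratic_profile. auto_derive; [easy|field].
      * intros x _. unfold h1, h2. auto_derive; [easy|ring].
  - set (Y := profile a delta alpha1 alpha2). exists Y.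
    assert (an : forall x, 0 < x -> analytic_at Y x) by now apply analytic_at_profile.
    assert (an' : forall x, 0 < x ->
      analytic_at (fun x => a * cosh (a * x) / sinh (a * x) * Y x ^ 2) x).
    { intros x Hx.
      apply (analytic_at_ext_loc (fun x => a * cosh (a * x) * / sinh (a * x) * (Y x * Y x))).
      - apply filter_forall. intros y. unfold Rdiv. ring.
      - analytic_at_arith; [now apply analytic_at_inv_sinh|now apply an..]. }
    repeat split.
    + now apply profile_smooth_with_initial_data.
    (* The radial part of the pressure is an antiderivative of [a coth (a r) Y^2]; it is smooth
       because the integrand is analytic. *)
    + set (dG := fun x => a * cosh (a * x) / sinh (a * x) * Y x ^ 2) in *.
      assert (DG : forall x, 0 < x -> is_derive (fun r => RInt dG delta r) x (dG x)).
      { intros x Hx. apply is_derive_RInt_pos; [easy| |easy].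
        intros t Ht. apply (ex_derive_continuous dG).
        apply (analytic_at_ex_derive_n dG t 1). now apply an'. }
      apply (satisfies_NS_of_constant_force a nu a_pos O e1 e2 HO He Y
        (profile1 a delta alpha1 alpha2) (profile2 a delta alpha1 alpha2)
        (fun r => RInt dG delta r) (profile_force a delta alpha1 alpha2)).
      * intros x Hx. now apply is_derive_profile.
      * intros x Hx. now apply is_derive_profile1.
      * intros x Hx. now apply azimuthal_force_profile.
      * intros n x Hx. apply analytic_at_ex_derive_n.
        apply (analytic_at_antiderivative _ dG); [|now apply an'].
        generalize (locally_gt 0 x Hx). apply filter_imp, DG.
      * easy.
    + intros Z (D & HZ & I0 & I1 & I2) NS.
      apply (profile_unique a a_pos delta delta_pos alpha1 alpha2 Z D); try easy.
      * rewrite (proj1 HZ); [easy|lra].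
      * assert (DD : forall n x, delta < x -> is_derive (D n) x (D (S n) x)).
        { intros n x Hx. apply (is_derive_of_within_interior delta); [easy|].
          apply (proj2 HZ). lra. }
        intros r r' Hr Hr'.
        (* The exterior region is unbounded, and [r + r'] is a radius exceeding both [r] and
           [r']. *)
        apply (azimuthal_force_constant a nu a_pos nu_pos O e1 e2 HO He Z (D 1%nat) (D 2%nat)
          (exterior_region a O e1 e2 delta tau) delta (r + r') tau); try lra; try easy.
        -- intros s th Hs Hth. apply polar_map_exterior; easy.
        -- intros x Hx. apply (is_derive_ext_loc (D 0%nat)); [|now apply DD].
           generalize (locally_gt delta x Hx). apply filter_imp.
           intros t Ht. apply (proj1 HZ). lra.
        -- intros x Hx. now apply DD.
    + intros x Hx. destruct (an x) as (c & rho & Hrho & H); [lra|].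
      exists c, rho. split; [easy|]. intros y _. apply H.
Qed.
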